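(* Let $\{X_i\}_{i\in\mathbb{Z}}$ be an admissible inverse system with parameter $m$. There is a constant $L=L(m)\in[1,\infty)$, depending only on $m$, and a $1$-Lipschitz map $f:(X_\infty,\bar d_\infty)\to L_1$ such that for all $x,y\in X_\infty$, $$\|f(x)-f(y)\|_{L_1}\ge L^{-1}\,\bar d_\infty(x,y).$$
   Context: Here $L_1$ means $L_1(Z,\mu)$ for some measure space $(Z,\mu)$. Graphs are identified with their geometric realizations; they need not be connected or have finite valence, and may contain isolated vertices. An inverse system of maps $\pi_i:X_{i+1}\to X_i$, $i\in\mathbb{Z}$, is admissible with parameter $m$ (an integer $\ge2$) if: (1) each $X_i$ is a nonempty directed graph; (2) if $X_i'$ is the directed graph obtained by subdividing each edge of $X_i$ into $m$ edges, then $\pi_i$ induces a map $X_{i+1}\to X_i'$ which is simplicial, an isomorphism on every edge, and direction preserving; (3) for all $i,j\in\mathbb{Z}$, $x\in X_i$, $x'\in X_j$, there is $k\le\min(i,j)$ such that $x,x'$ project to the same connected component of $X_k$. $X_\infty$ is the inverse limit, with projections $\pi_i^\infty:X_\infty\to X_i$. For a vertex $v$ of $X_i$, the closed star $\operatorname{St}(v,X_i)$ is the union of $\{v\}$ and all edges of $X_i$ containing $v$. $\bar d_\infty$ is the supremal pseudo-distance on $X_\infty$ such that for every $i\in\mathbb{Z}$ and every vertex $v\in X_i$, $(\pi_i^\infty)^{-1}(\operatorname{St}(v,X_i))$ has diameter at most $2m^{-i}$ (it is a metric). *)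

(* Defs.v *)
From HB Require Import structures.
From Stdlib Require Import Relation_Operators.
From mathcomp Require Import all_boot all_order all_algebra.
From mathcomp Require Import all_classical all_reals all_analysis.
Import Order.TTheory GRing.Theory Num.Theory.
Import numFieldNormedType.Exports.

Set Implicit Arguments.
Unset Strict Implicit.
Unset Printing Implicit Defensive.

Local Open Scope classical_set_scope.
Local Open Scope ring_scope.

(* Arbitrary cardinality and valence; isolated vertices, parallel edges and
   loops are allowed. *)
Record digraph := Digraph {
  vertex : Type;
  edge : Type;
  source : edge -> vertex;
  target : edge -> vertex }.

Record digraph_hom (X Y : digraph) := DigraphHom {
  hom_vertex : vertex X -> vertex Y;
  hom_edge : edge X -> edge Y;
  hom_source : forall e, source (hom_edge e) = hom_vertex (source e);
  hom_target : forall e, target (hom_edge e) = hom_vertex (target e) }.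

(* In [subdivision m X] each edge [e] is replaced by the directed path
   [cut_vertex m e 0 -> cut_vertex m e 1 -> ... -> cut_vertex m e m], which
   starts at [source e], ends at [target e] and has [m - 1] new vertices. *)
Definition cut_vertex (m : nat) (X : digraph) (e : edge X) (k : nat) :
    vertex X + edge X * 'I_m.-1 :=
  if k is j.+1 then
    if insub j is Some i then inr (e, i) else inl (target e)
  else inl (source e).

Definition subdivision (m : nat) (X : digraph) : digraph :=
  {| vertex := (vertex X + edge X * 'I_m.-1)%type;
     edge := (edge X * 'I_m)%type;
     source := fun ek => cut_vertex m ek.1 ek.2;
     target := fun ek => cut_vertex m ek.1 ek.2.+1 |}.

(* The point set of the geometric realization: the vertices, together with
   one copy of the open unit interval for each edge. *)
Inductive realization (R : realType) (X : digraph) : Type :=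
| Vertex of vertex X
| Inner of edge X & {t : R | 0 < t < 1}.
Arguments Vertex {R X}.
Arguments Inner {R X}.

(* The characteristic map [0, 1] -> |X| of the edge [e]; only parameters
   [0 <= t <= 1] are meaningful. *)
Definition edge_point (R : realType) (X : digraph) (e : edge X) (t : R) :
    realization R X :=
  if insub t is Some u then Inner e u
  else Vertex (if t <= 0 then source e else target e).

Definition closed_edge (R : realType) (X : digraph) (e : edge X) :
    set (realization R X) :=
  [set edge_point e t | t in [set t : R | 0 <= t <= 1]].

Definition closed_star (R : realType) (X : digraph) (v : vertex X) :
    set (realization R X) :=
  [set Vertex v] `|`
  \bigcup_(e in [set e | source e = v \/ target e = v]) closed_edge e.

Definition same_component (R : realType) (X : digraph) :
    realization R X -> realization R X -> Prop :=
  clos_refl_trans _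
    (fun p q => exists e : edge X, closed_edge e p /\ closed_edge e q).

Definition realize_hom (R : realType) (X Y : digraph) (h : digraph_hom X Y)
    (p : realization R X) : realization R Y :=
  match p with
  | Vertex v => Vertex (hom_vertex h v)
  | Inner e t => Inner (hom_edge h e) t
  end.

(* The canonical identification |X'| = |X|: the [k]-th piece of [e] is the
   subinterval [k/m, (k+1)/m] of [e]. *)
Definition unsubdivide (R : realType) (m : nat) (X : digraph)
    (p : realization R (subdivision m X)) : realization R X :=
  match p with
  | Vertex (inl v) => Vertex v
  | Vertex (inr (e, j)) => edge_point e (j.+1%:R / m%:R)
  | Inner (e, k) t => edge_point e ((k%:R + val t) / m%:R)
  end.

(* [f] is, after subdivision of the target, induced by a morphism of directed
   graphs, hence maps each edge of [Y] isomorphically, preserving direction, to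
   an edge of the subdivision. *)
Definition simplicial_after_subdivision (R : realType) (m : nat)
    (Y X : digraph) (f : realization R Y -> realization R X) : Prop :=
  exists h : digraph_hom Y (subdivision m X),
    forall p, f p = unsubdivide (realize_hom h p).

Section InverseSystem.
Context (R : realType) (X : int -> digraph).
Context (proj : forall i : int, realization R (X (i + 1)) -> realization R (X i)).

(* [projects_to x y]: [y] is the image of [x] under a composition, possibly
   empty, of consecutive maps of the system. *)
Inductive projects_to :
    forall i : int, realization R (X i) ->
    forall k : int, realization R (X k) -> Prop :=
| projects_refl i (x : realization R (X i)) : projects_to x x
| projects_step i (x : realization R (X (i + 1)))
    k (y : realization R (X k)) :
    projects_to (proj x) y -> projects_to x y.

Record admissible (m : nat) : Prop := Admissible {
  admissible_ge2 : (2 <= m)%N;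
  admissible_nonempty : forall i, inhabited (vertex (X i));
  admissible_simplicial :
    forall i, simplicial_after_subdivision m (@proj i);
  admissible_connected :
    forall (i j : int) (x : realization R (X i)) (x' : realization R (X j)),
    exists (k : int) (y y' : realization R (X k)),
      [/\ k <= Num.min i j, projects_to x y, projects_to x' y' &
          same_component y y'] }.

Definition inverse_limit : Type :=
  {x : forall i : int, realization R (X i) |
    forall i : int, proj (x (i + 1)) = x i}.

Definition limit_proj (i : int) (x : inverse_limit) : realization R (X i) :=
  sval x i.

End InverseSystem.

Definition pseudo_distance (R : realType) (T : Type) (rho : T -> T -> R) :
    Prop :=
  [/\ forall x y, 0 <= rho x y,
      forall x, rho x x = 0,
      forall x y, rho x y = rho y x &
      forall x y z, rho x z <= rho x y + rho y z].

Definition diam_le (R : realType) (T : Type) (rho : T -> T -> R) (A : set T)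
    (c : R) : Prop :=
  forall x y, A x -> A y -> rho x y <= c.

Definition star_bounded (R : realType) (m : nat) (X : int -> digraph)
    (proj : forall i : int, realization R (X (i + 1)) -> realization R (X i))
    (rho : inverse_limit proj -> inverse_limit proj -> R) : Prop :=
  forall (i : int) (v : vertex (X i)),
    diam_le rho (@limit_proj R X proj i @^-1` closed_star v)
      (2 * m%:R ^ (- i)).

(* The supremum is taken pointwise. For an admissible system it is finite, as
   any two points of the limit project into a common star of some [X i]. *)
Definition dbar (R : realType) (m : nat) (X : int -> digraph)
    (proj : forall i : int, realization R (X (i + 1)) -> realization R (X i))
    (x y : inverse_limit proj) : R :=
  sup [set rho x y | rho in
        [set rho | pseudo_distance rho /\ star_bounded m rho]].

(* The library does not equip its space [LspaceType1 mu] of a.e.-classes of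
   integrable functions with a subtraction, so the difference is that of
   representatives. *)
Definition L1_dist (R : realType) (d : measure_display) (Z : measurableType d)
    (mu : {measure set Z -> \bar R}) (f g : LspaceType1 mu) : \bar R :=
  Lnorm mu 1%E (fun z => ((f : Z -> R) z - (g : Z -> R) z)%:E).

(* Main.v *)
Require Import Defs.
From HB Require Import structures.
From mathcomp Require Import all_boot all_order all_algebra.
From mathcomp Require Import all_classical all_reals all_analysis.
From mathcomp Require Import measurable_realfun lra ring zify.
From mathcomp Require finmap.
Import Order.TTheory GRing.Theory Num.Theory.
Import numFieldNormedType.Exports.

(** Why the theorem holds.

The cells (vertices or open edges) of the projections of two points determine
their distance up to a factor.  Write [scale i] for [m ^ (- i)].  Points whose
cells at level [i] have a common vertex lie in a common closed star, so that
their distance is at most [2 * scale i].  It therefore suffices to find a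
pseudo-distance induced by a map into an L1 space which is at most [2 * scale i]
on every closed star of level [i], hence below [dbar], and at least a fixed
multiple of [scale (i + 1)] for points that are near at level [i] but apart at
level [i + 1].

A measure on the cuts of a set defines such a pseudo-distance, the mass of the
cuts that separate two points.  Cuts are built at random by refinement.  At
each level a vertex is [below], [above], or [on] the slice.  A new vertex over a
vertex that is [on] draws a side of its own; an edge that crosses the cut draws
a threshold among its [m] pieces and the points between them.  The laws of the draws are
chosen such that the mass of the cuts through a vertex, or across an edge, is a
fixed multiple of [scale i] at all levels, with no loss from level to level
([slicing_step]).  A cell that lies on a decided side stays there
([constant_refine]).  Hence points of a common star are separated by mass at most
[4 * scale i] ([star_pair_bound]).  Conversely, if the cells of two points have
no common vertex, then the points depend on different, independent draws: with
probability bounded below one point settles ([settle]), and on an event of mass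
at least [scale i / m] the other one can be steered to the opposite side within
two steps ([poised_after_event], [poised_settle]).  This is the induction of
[good_law_step].

The process is started on a finite set of points.  At a sufficiently coarse level
their cells surround a single vertex ([centred]), and cutting its star by height
gives the initial law ([star_slicing]).  Finitely many constraints can thus be
satisfied ([finite_cuts]).  The space of all cuts being compact, an ultrafilter
limit of the finite measures is a countably additive content on clopen sets, which
extends to a measure satisfying all constraints at once
([L1_embedding_from_finite_cuts]). *)

Set Implicit Arguments.
Unset Strict Implicit.
Unset Printing Implicit Defensive.

Local Open Scope classical_set_scope.
Local Open Scope ring_scope.

(** * Weighted lists as finite measures *)

Section WeightedLists.
Context (R : realType).

Definition ind (P : Prop) : R := (`[< P >] : bool)%:R.

Lemma ind_true (P : Prop) : P -> ind P = 1.
Proof. by move=> /asboolT; rewrite /ind => ->. Qed.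

Lemma ind_false (P : Prop) : ~ P -> ind P = 0.
Proof. by move=> /asboolF; rewrite /ind => ->. Qed.

Lemma ind_ge0 (P : Prop) : 0 <= ind P.
Proof. by rewrite /ind; case: asbool. Qed.

Lemma ind_mono (P Q : Prop) : (P -> Q) -> ind P <= ind Q.
Proof.
move=> PQ; have [p|np] := pselect P.
  by rewrite (ind_true p) (ind_true (PQ p)).
by rewrite (ind_false np) ind_ge0.
Qed.

Lemma ind_iff (P Q : Prop) : (P <-> Q) -> ind P = ind Q.
Proof. by move=> PQ; rewrite (propext PQ). Qed.

(** A list of weighted points is a finite measure, and [mean] is the integral
against it.  Lists, rather than functions on finite types, are convenient
because the points carried here are functions on arbitrary vertex types. *)
Definition mean (A : Type) (mu : seq (R * A)) (g : A -> R) : R :=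
  \sum_(p <- mu) p.1 * g p.2.

Definition mass (A : Type) (mu : seq (R * A)) (P : A -> Prop) : R :=
  mean mu (fun a => ind (P a)).

Definition weighted (A : Type) (mu : seq (R * A)) : Prop :=
  all (fun p => 0 <= p.1) mu.

Definition supported (A : Type) (P : A -> Prop) (mu : seq (R * A)) : Prop :=
  all (fun p => `[< P p.2 >]) mu.

(** Composition of a finite measure with a kernel. *)
Definition bind (A B : Type) (mu : seq (R * A)) (k : A -> seq (R * B)) :=
  flatten [seq [seq (p.1 * q.1, q.2) | q <- k p.2] | p <- mu].

Lemma supportedT (A : Type) (mu : seq (R * A)) : supported (fun=> True) mu.
Proof. by elim: mu => //= p mu; rewrite /supported /= asboolT. Qed.

Section Mean.
Context (A B : Type).
Implicit Types (mu : seq (R * A)) (k : A -> seq (R * B)) (P Q : A -> Prop).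

Lemma le_mean mu P (f g : A -> R) : weighted mu -> supported P mu ->
  (forall a, P a -> f a <= g a) -> mean mu f <= mean mu g.
Proof.
rewrite /mean; elim: mu => [|p mu IH]; first by rewrite !big_nil.
rewrite !big_cons => /andP[p0 w] /andP[/asboolP Pp s] fg.
by apply: lerD; [exact: ler_wpM2l (fg _ _) | exact: IH].
Qed.

Lemma eq_mean mu P (f g : A -> R) : supported P mu ->
  (forall a, P a -> f a = g a) -> mean mu f = mean mu g.
Proof.
rewrite /mean; elim: mu => [|p mu IH]; first by rewrite !big_nil.
rewrite !big_cons => /andP[/asboolP Pp s] fg.
by rewrite fg // IH.
Qed.

Lemma mean_ge0 mu (f : A -> R) :
  weighted mu -> (forall a, 0 <= f a) -> 0 <= mean mu f.
Proof.
rewrite /mean; elim: mu => [|p mu IH]; first by rewrite big_nil.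
rewrite big_cons => /andP[p0 w] f0.
by apply: addr_ge0; [exact: mulr_ge0 | exact: IH].
Qed.

Lemma meanD mu (f g : A -> R) :
  mean mu (fun a => f a + g a) = mean mu f + mean mu g.
Proof.
by rewrite /mean -big_split; apply: eq_bigr => p _; rewrite mulrDr.
Qed.

Lemma meanZ mu (c : R) (f : A -> R) :
  mean mu (fun a => c * f a) = c * mean mu f.
Proof. by rewrite /mean big_distrr; apply: eq_bigr => p _; rewrite mulrCA. Qed.

(** Fubini, in the form in which all conditional estimates are integrated. *)
Lemma mean_bind mu k g : mean (bind mu k) g = mean mu (fun a => mean (k a) g).
Proof.
rewrite /mean /bind; elim: mu => [|p mu IH]; first by rewrite !big_nil.
rewrite /= big_cat big_cons IH; congr (_ + _).
rewrite big_map big_distrr /=; apply: eq_bigr => q _.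
by rewrite mulrA.
Qed.

Lemma weighted_bind mu k :
  weighted mu -> (forall a, weighted (k a)) -> weighted (bind mu k).
Proof.
move=> w wk; elim: mu w => //= p mu IH /andP[p0 w].
rewrite /weighted /bind /= all_cat; apply/andP; split; last exact: IH.
rewrite all_map; have := wk p.2; apply: sub_all => q /= q0.
exact: mulr_ge0.
Qed.

Lemma supported_bind mu k P (Q : B -> Prop) : supported P mu ->
  (forall a, P a -> supported Q (k a)) -> supported Q (bind mu k).
Proof.
move=> s sk; elim: mu s => //= p mu IH /andP[/asboolP Pp s].
rewrite /supported /bind /= all_cat; apply/andP; split; last exact: IH.
by rewrite all_map; have := sk _ Pp; apply: sub_all.
Qed.

Lemma mass_ge0 mu P : weighted mu -> 0 <= mass mu P.
Proof. by move=> w; apply: mean_ge0 => // a; exact: ind_ge0. Qed.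

Lemma le_mass_on mu S P Q : weighted mu -> supported S mu ->
  (forall a, S a -> P a -> Q a) -> mass mu P <= mass mu Q.
Proof. by move=> w s PQ; apply: (le_mean w s) => a Sa; apply: ind_mono; exact: PQ. Qed.

Lemma le_mass mu P Q : weighted mu ->
  (forall a, P a -> Q a) -> mass mu P <= mass mu Q.
Proof. by move=> w PQ; apply: (le_mass_on w (supportedT mu)) => a _; exact: PQ. Qed.

Lemma eq_mass mu P Q : (forall a, P a <-> Q a) -> mass mu P = mass mu Q.
Proof. by move=> PQ; congr mass; apply/funext => a; apply/propext. Qed.

Lemma massU mu P Q : (forall a, P a -> Q a -> False) ->
  mass mu (fun a => P a \/ Q a) = mass mu P + mass mu Q.
Proof.
move=> PQ; rewrite /mass -meanD; congr mean; apply/funext => a.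
have [p|np] := pselect (P a).
  rewrite (ind_true (or_introl p)) (ind_true p) ind_false ?addr0 //.
  exact: PQ.
rewrite (ind_false np) add0r; apply: ind_iff; split => [[//|//]|q].
by right.
Qed.

Lemma le_massU mu P Q : weighted mu ->
  mass mu (fun a => P a \/ Q a) <= mass mu P + mass mu Q.
Proof.
move=> w; rewrite /mass -meanD; apply: (le_mean w (supportedT mu)) => a _.
have [p|np] := pselect (P a).
  by rewrite (ind_true (or_introl p)) (ind_true p) lerDl ind_ge0.
rewrite (ind_false np) add0r; apply: ind_mono => -[//|//].
Qed.

End Mean.

Lemma mean_map (A B : Type) (f : A -> B) (mu : seq (R * A)) g :
  mean [seq (p.1, f p.2) | p <- mu] g = mean mu (fun a => g (f a)).
Proof. by rewrite /mean big_map. Qed.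

Lemma weighted_map (A B : Type) (f : A -> B) (mu : seq (R * A)) :
  weighted mu -> weighted [seq (p.1, f p.2) | p <- mu].
Proof. by rewrite /weighted all_map. Qed.

Lemma supported_map (A B : Type) (f : A -> B) (mu : seq (R * A)) Q :
  (forall a, Q (f a)) -> supported Q [seq (p.1, f p.2) | p <- mu].
Proof.
by move=> Qf; rewrite /supported all_map; elim: mu => //= p mu ->; rewrite asboolT.
Qed.

End WeightedLists.

(** * Limits of finite cut measures *)

(** Compactness of the segment provides a cluster point, and along an
ultrafilter a cluster point is a limit. *)
Lemma ultra_cvg_bounded (R : realType) (I : Type) (U : set_system I)
    (u : I -> R) (M : R) :
  UltraFilter U -> U [set i | 0 <= u i <= M] ->
  exists2 l : R, 0 <= l <= M & u i @[i --> U] --> l.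
Proof.
move=> UU UM.
have PU := @ultra_proper _ _ UU.
have UI : (u @ U) `[0, M]%classic.
  change (U (u @^-1` `[0, M]%classic)).
  by apply: filterS UM => i /=; rewrite in_itv /=.
have [l [l0M cl]] := @segment_compact R 0 M (u @ U) _ UI.
exists l => /=; first by move: l0M; rewrite /= in_itv.
move=> B lB; have [//|UnB] := in_ultra_setVsetC (u @^-1` B) UU.
have UnB' : (u @ U) (~` B) by exact: UnB.
by have [r []] := cl _ _ UnB' lB.
Qed.

(** A cut of [T] is a subset, seen as a point of the product of copies of
[bool]; the alias carries the product topology. *)
Definition cut_space (T : choiceType) : Type := T -> bool.

HB.instance Definition _ (T : choiceType) :=
  Topological.copy (cut_space T) (prod_topology (fun _ : T => bool)).
HB.instance Definition _ (T : choiceType) :=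
  isPointed.Build (cut_space T) (fun _ : T => false).

Lemma cut_space_compact (T : choiceType) : compact [set: cut_space T].
Proof.
have := @tychonoff T (fun _ => bool) (fun _ => setT) (fun _ => bool_compact).
by congr (compact _); rewrite eqEsubset; split.
Qed.

Definition cut_at (T : choiceType) (x : T) : set (cut_space T) :=
  [set A | A x].

Lemma cut_at_clopen (T : choiceType) (x : T) : clopen (cut_at x).
Proof.
have -> : cut_at x = (fun A : cut_space T => A x) @^-1` [set true].
  by rewrite eqEsubset; split => A.
apply: preimage_clopen.
  by split; [exact: discrete_open | exact: discrete_closed].
exact: (@proj_continuous _ (fun _ : T => bool) x).
Qed.

Definition no_cut (T : choiceType) : cut_space T := fun=> false.

(** Cuts are normalised so that a base point lies outside of them, which makes
the empty cut the only one that separates nothing.  It may carry infinite mass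
in the limit; the clopen sets that avoid it form a ring on which all limits
are finite. *)
Definition small_clopen (T : choiceType) : set (set (cut_space T)) :=
  [set C | clopen C /\ ~ C (@no_cut T)].

Lemma small_clopen0 (T : choiceType) : small_clopen (@set0 (cut_space T)).
Proof. by split => //; exact: clopen0. Qed.

Lemma small_clopenU (T : choiceType) : setU_closed (@small_clopen T).
Proof.
by move=> A B [cA nA] [cB nB]; split; [exact: clopenU | move=> []].
Qed.

Lemma small_clopenD (T : choiceType) : setD_closed (@small_clopen T).
Proof.
move=> A B [cA nA] [cB nB]; split; last by move=> [].
by rewrite setDE; apply: clopenI => //; exact: clopenC.
Qed.

HB.instance Definition _ (T : choiceType) :=
  @isRingOfSets.Build default_measure_display (cut_space T)
    (@small_clopen T) (@small_clopen0 T) (@small_clopenU T) (@small_clopenD T).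

Lemma clopen_cut_compact (T : choiceType) (C : set (cut_space T)) :
  clopen C -> compact C.
Proof.
move=> [_ cC]; apply: (subclosed_compact cC (@cut_space_compact T)).
exact: subsetT.
Qed.

Definition cut_somewhere (T : choiceType) (s : seq T) : set (cut_space T) :=
  [set A | exists2 x, x \in s & A x].

(** A nonempty cut contains some point, so a clopen set that avoids the empty
cut is covered by the open sets [cut_at x]; compactness selects finitely
many. *)
Lemma small_clopen_cover (T : choiceType) (C : set (cut_space T)) :
  small_clopen C ->
  exists s : seq T, C `<=` cut_somewhere s.
Proof.
move=> [cC nC].
have := clopen_cut_compact cC; rewrite compact_cover.
move=> /(_ T setT (@cut_at T)) [x _|A CA|D' _ CD'].
- by have [] := cut_at_clopen x.
- have [[x Ax]|nA] := pselect (exists x, A x); first by exists x.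
  exfalso; apply: nC; suff <- : A = @no_cut T by [].
  apply/funext => x; apply/negbTE/negP => Ax.
  by apply: nA; exists x.
- exists (finmap.enum_fset D') => A /CD' [x xD' Ax].
  by exists x.
Qed.

Lemma clopen_bigcup_finite (T : choiceType) (F : (set (cut_space T))^nat) :
  (forall i, clopen (F i)) -> clopen (\bigcup_i F i) ->
  exists n, \bigcup_i F i `<=` \bigcup_(i < n) F i.
Proof.
move=> cF cU.
have := clopen_cut_compact cU; rewrite compact_cover.
move=> /(_ nat setT F) [i _|A //|D' _ CD']; first by have [] := cF i.
exists (\max_(i <- finmap.enum_fset D') i).+1 => A /CD' [i iD' Fi].
exists i => //=; rewrite ltnS.
have {}iD' : i \in finmap.enum_fset D' by [].
exact: (@leq_bigmax_seq _ (finmap.enum_fset D') xpredT id).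
Qed.

Section LimitContent.
Context (R : realType) (T : choiceType) (I : Type) (U : set_system I).
Context (UU : UltraFilter U) (N : I -> set (cut_space T) -> R).
Hypothesis N_ge0 : forall i C, 0 <= N i C.
Hypothesis NU : forall i C D, C `&` D = set0 -> N i (C `|` D) = N i C + N i D.
Hypothesis N_bounded : forall x, exists M, U [set i | N i (cut_at x) <= M].

(** The absolute value makes the content nonnegative on every set, including
those on which the limit does not exist. *)
Definition limit_content (C : set (cut_space T)) : R :=
  `|lim (N i C @[i --> U])|.

Let PU : ProperFilter U := @ultra_proper _ _ UU.

Let le_N i C D : C `<=` D -> N i C <= N i D.
Proof.
move=> CD; have -> : D = C `|` (D `\` C) by rewrite setDUK.
by rewrite NU ?lerDl ?N_ge0 // setDIK.
Qed.

(** By [small_clopen_cover] the values are eventually bounded by finitely many of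
the bounds on the sets [cut_at x]. *)
Lemma limit_content_cvg C : small_clopen C ->
  N i C @[i --> U] --> limit_content C.
Proof.
move=> sC; have [s Cs] := small_clopen_cover sC.
suff [M UM] : exists M, U [set i | N i (cut_somewhere s) <= M].
  have [|l /andP[l0 _] Nl] := @ultra_cvg_bounded R I U (N ^~ C) M UU.
    apply: filterS UM => i /= Ni; rewrite N_ge0 /=.
    by apply: le_trans Ni; exact: le_N.
  by rewrite /limit_content (cvg_lim _ Nl) // ger0_norm.
elim: s {C sC Cs} => [|x s [M UM]].
  exists 0; apply: filterE => i /=.
  have -> : @cut_somewhere T [::] = set0.
    by rewrite eqEsubset; split => // A [].
  by have := @NU i set0 set0 (setI0 _); rewrite setU0; lra.
have [M' UM'] := N_bounded x.
exists (M' + M); apply: filterS2 UM UM' => i NM NM' /=.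
apply: (@le_trans _ _ (N i (cut_at x) + N i (cut_somewhere s `\` cut_at x))).
  rewrite -NU ?setDIK //.
  apply: le_N => A [y]; rewrite in_cons => /orP[/eqP -> Ax|ys Ay].
    by left.
  by have [|] := pselect (cut_at x A); [left|right; split => //; exists y].
by apply: lerD => //; apply: le_trans NM; apply: le_N; exact: subDsetl.
Qed.

Lemma limit_content_ge0 C : 0 <= limit_content C.
Proof. exact: normr_ge0. Qed.

Lemma limit_contentU C D : small_clopen C -> small_clopen D ->
  C `&` D = set0 -> limit_content (C `|` D) = limit_content C + limit_content D.
Proof.
move=> sC sD CD0.
have cU := limit_content_cvg (small_clopenU sC sD).
have NE : (fun i => N i (C `|` D)) = (fun i => N i C + N i D).
  by apply/funext => i; rewrite NU.
rewrite NE in cU; apply: (cvg_unique _ cU) => //.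
by apply: cvgD; exact: limit_content_cvg.
Qed.

Lemma limit_content0 : limit_content set0 = 0.
Proof.
have := limit_contentU (@small_clopen0 T) (@small_clopen0 T) (setI0 _).
by rewrite setU0; lra.
Qed.

Lemma limit_content_bigsetU (F : (set (cut_space T))^nat) n :
  (forall i, small_clopen (F i)) -> trivIset setT F ->
  small_clopen (\big[setU/set0]_(i < n) F i) /\
  limit_content (\big[setU/set0]_(i < n) F i) =
    \sum_(0 <= i < n) limit_content (F i).
Proof.
move=> sF tF; elim: n => [|n [sn IH]].
  by rewrite big_ord0 big_nil limit_content0; split => //; exact: small_clopen0.
rewrite big_ord_recr /= big_nat_recr //=; split; first exact: small_clopenU.
rewrite limit_contentU ?IH // -bigcup_mkord.
rewrite setI_bigcupl; apply: bigcup0 => i /= ltin.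
move/trivIsetP: tF => /(_ i n Logic.I Logic.I); apply.
by rewrite neq_ltn ltin.
Qed.

(** A disjoint sequence of clopen sets with clopen union has only finitely many
nonempty terms, by compactness; countable additivity is then finite
additivity. *)
Lemma limit_content_sigma_additive :
  semi_sigma_additive (fun C : set (cut_space T) => (limit_content C)%:E).
Proof.
move=> F mF tF mU.
have [n Un] : exists n, \bigcup_i F i `<=` \bigcup_(i < n) F i.
  by apply: clopen_bigcup_finite => [i|]; [case: (mF i)|case: mU].
have UE k : (n <= k)%N -> \big[setU/set0]_(i < k) F i = \bigcup_i F i.
  move=> nk; rewrite -bigcup_mkord eqEsubset; split => A.
    by move=> [i _ FA]; exists i.
  by move=> /Un [i /= ltin FA]; exists i => //=; exact: leq_trans nk.
apply: cvg_near_cst; exists n => // k /= nk.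
rewrite sumEFin; congr EFin.
by have [_ <-] := limit_content_bigsetU k mF tF; rewrite UE.
Qed.

Lemma limit_content_measure :
  exists mu : {measure set (cut_space T) -> \bar R},
    forall C, mu C = (limit_content C)%:E.
Proof.
pose nu (C : set (cut_space T)) := (limit_content C)%:E.
have nu0 : nu set0 = 0%:E by rewrite /nu limit_content0.
have nu_ge0 C : (0 <= nu C)%E by rewrite lee_fin limit_content_ge0.
pose m := isMeasure.Build _ (cut_space T) R nu nu0 nu_ge0
  limit_content_sigma_additive.
pose M : {measure set (cut_space T) -> \bar R} := HB.pack nu m.
by exists M.
Qed.

End LimitContent.

(** * Indicators as classes of integrable functions *)

Section IndicatorClasses.
Context (d : measure_display) (Z : measurableType d) (R : realType).
Context (mu : {measure set Z -> \bar R}).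

Lemma indicator_in_L1 (D : set Z) : measurable D -> (mu D < +oo)%E ->
  exists f : LspaceType1 mu, (f : Z -> R) = \1_D %[ae mu].
Proof.
move=> mD muD.
have m1D : measurable_fun [set: Z] (\1_D : Z -> measurableTypeR R).
  exact: measurable_indic.
pose g : {mfun Z >-> measurableTypeR R} :=
  HB.pack (\1_D : Z -> measurableTypeR R) (isMeasurableFun.Build _ _ _ _ _ m1D).
pose q : {mfun_ mu, Z >-> measurableTypeR R} :=
  (\pi_({mfun_ mu, Z >-> measurableTypeR R})%qT g).
have qE : (q : Z -> R) = \1_D %[ae mu].
  have /eqP := reprK q; rewrite eqmodE => /asboolP.
  exact.
have fq : finite_norm mu 1%E (q : Z -> R).
  rewrite /finite_norm Lnorm1.
  rewrite (ae_eq_integral (fun z => `|(\1_D z)%:E|)%E) //; last first.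
  - by apply: filterS qE => z qz _ /=; rewrite qz.
  - by apply/measurable_EFinP; apply: measurableT_comp.
  - apply: measurableT_comp => //; apply/measurable_EFinP.
    exact: (@measurable_funPT _ _ Z (measurableTypeR R) (repr q)).
  under eq_integral do rewrite gee0_abs ?lee_fin //.
  by rewrite integral_indic // setIT.
pose m := @isFinLebesgue.Build d Z R mu 1%E (lexx 1%E) q fq.
pose f : LspaceType1 mu := HB.pack q m.
by exists f.
Qed.

Lemma L1_dist_indicators (C D : set Z) (f g : LspaceType1 mu) :
  measurable C -> measurable D ->
  (f : Z -> R) = \1_C %[ae mu] -> (g : Z -> R) = \1_D %[ae mu] ->
  L1_dist f g = mu ((C `\` D) `|` (D `\` C)).
Proof.
move=> mC mD fC gD; rewrite /L1_dist Lnorm1.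
have mY : measurable ((C `\` D) `|` (D `\` C)).
  by apply: measurableU; exact: measurableD.
have mrepr (h : LspaceType1 mu) : measurable_fun [set: Z] (h : Z -> R).
  exact: (@measurable_funPT _ _ Z (measurableTypeR R)
    (repr (h : {mfun_ mu, Z >-> measurableTypeR R}))).
rewrite (ae_eq_integral
  (fun z => (\1_((C `\` D) `|` (D `\` C)) z)%:E)%E) //; last first.
- apply: filterS2 fC gD => z fz gz _ /=; rewrite fz // gz //.
  congr EFin; rewrite !indicE in_setU !in_setD.
  by case: (z \in C); case: (z \in D); rewrite /= ?subrr ?subr0 ?sub0r ?normrN ?normr1 ?normr0.
- by apply/measurable_EFinP; exact: measurable_indic.
- apply: measurableT_comp => //; apply/measurable_EFinP.
  by apply: measurable_funB; exact: mrepr.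
by rewrite integral_indic // setIT.
Qed.

End IndicatorClasses.

(** * Compactness: finite cut measures yield a map into an L1 space *)

Definition cut_symdiff (T : choiceType) (x y : T) : set (cut_space T) :=
  (cut_at x `\` cut_at y) `|` (cut_at y `\` cut_at x).

Lemma cut_symdiffP (T : choiceType) (x y : T) (A : cut_space T) :
  cut_symdiff x y A <-> A x <> A y.
Proof.
rewrite /cut_symdiff /cut_at /=; case: (A x); case: (A y); split => //.
- by case=> -[].
- by left.
- by right.
- by case=> -[].
Qed.

(** A quadruple [(x, y, a, b)] of [C] asks that the distance of [x] and [y] lie
between [a] and [b].  If each finite part of [C] is met by a finite measure on
cuts, with the mass of the cuts that separate [x] from [y] as distance, then the
limit of these measures along an ultrafilter, finer than the filter of larger
and larger parts, meets all of [C].  The point [x] is sent to the indicator of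
the set of cuts that contain [x]; two indicators differ exactly on the cuts
that separate the points.  No separable measure space would do in general,
since uncountably many points may be at mutual distance at least one inside a
bounded set. *)
Theorem L1_embedding_from_finite_cuts (R : realType) (T : choiceType) (x0 : T)
    (C : set (T * T * R * R)) :
  (forall x y, exists a b, C (x, y, a, b)) ->
  (forall s : seq (T * T * R * R), (forall c, c \in s -> C c) ->
    exists mu : seq (R * (T -> bool)), weighted mu /\
      forall x y a b, (x, y, a, b) \in s ->
        a <= mass mu (fun A => A x <> A y) <= b) ->
  exists (d : measure_display) (Z : measurableType d)
    (mu : {measure set Z -> \bar R}) (f : T -> LspaceType1 mu) (rho : T -> T -> R),
    [/\ pseudo_distance rho,
        forall x y, L1_dist (f x) (f y) = (rho x y)%:E &
        forall x y a b, C (x, y, a, b) -> a <= rho x y <= b].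
Proof.
move=> Ctotal Cfin.
pose K := (T * T * R * R)%type.
pose valid (s : seq K) := forall c, c \in s -> C c.
have [mu_ mu_P] : {mu_ : seq K -> seq (R * cut_space T) &
    forall s, [/\ weighted (mu_ s), supported (fun A : cut_space T => ~ A x0) (mu_ s) &
      valid s -> forall x y a b, (x, y, a, b) \in s ->
        a <= mass (mu_ s) (cut_symdiff x y) <= b]}.
  apply: (@choice _ _ (fun s mu => [/\ weighted mu, supported (fun A : cut_space T => ~ A x0) mu &
      valid s -> forall x y a b, (x, y, a, b) \in s ->
        a <= mass mu (cut_symdiff x y) <= b])) => s.
  have [vs|nvs] := pselect (valid s); last by exists [::].
  have [mu [wmu mus]] := Cfin s vs.
  pose flip (A : T -> bool) : cut_space T := fun x => A x (+) A x0.
  exists [seq (p.1, flip p.2) | p <- mu]; split.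
  - exact: (weighted_map flip wmu).
  - by apply: (supported_map (f := flip)) => A; rewrite /flip addbb.
  - move=> _ x y a b /mus; rewrite /mass (mean_map flip).
    set g := (X in mean _ X) => gab.
    suff -> : (fun A => ind R (cut_symdiff x y (flip A))) = g by [].
    apply/funext => A; apply: ind_iff.
    by rewrite cut_symdiffP /flip; case: (A x); case: (A y); case: (A x0).
(* Larger and larger finite sets of constraints. *)
pose F0 := filter_from valid (fun s => [set s' | valid s' /\ {subset s <= s'}]).
have PF0 : ProperFilter F0.
  apply: filter_from_proper; last by move=> s vs; exists s; split.
  apply: filter_from_filter; first by exists [::].
  move=> s t vs vt; exists (s ++ t).
    by move=> c; rewrite mem_cat => /orP[/vs|/vt].
  move=> r [vr str]; split; split=> // c cs; apply: str; rewrite mem_cat cs //.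
  by rewrite orbT.
have [U [UU F0U]] := ultraFilterLemma PF0.
have PU : ProperFilter U := @ultra_proper _ _ UU.
pose N s (D : set (cut_space T)) := mass (mu_ s) D.
have N_ge0 s D : 0 <= N s D by apply: mass_ge0; case: (mu_P s).
have NU s D E : D `&` E = set0 -> N s (D `|` E) = N s D + N s E.
  by move=> DE0; apply: massU => A DA EA; have : set0 A by rewrite -DE0.
have UC x y a b : C (x, y, a, b) -> U [set s | a <= N s (cut_symdiff x y) <= b].
  move=> Cc; apply: F0U; exists [:: (x, y, a, b)].
    by move=> c; rewrite inE => /eqP ->.
  move=> s [vs sub]; have [_ _ ms] := mu_P s; apply: (ms vs).
  by apply: sub; rewrite inE.
have N_bounded x : exists M, U [set s | N s (cut_at x) <= M].
  have [a [b Cc]] := Ctotal x x0; exists b.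
  apply: filterS (UC _ _ _ _ Cc) => s /= /andP[_]; apply: le_trans.
  have [w sup _] := mu_P s.
  apply: (le_mass_on w sup) => A /= nA Ax; left; split => //.
pose lam := limit_content U N.
have [mu muE] := limit_content_measure UU N_ge0 NU N_bounded.
have small_at (x : T) : small_clopen (cut_at x).
  by split; [exact: cut_at_clopen | ].
have small_sd (x y : T) : small_clopen (cut_symdiff x y).
  by apply: small_clopenU; exact: small_clopenD.
pose Z := g_sigma_algebraType (@measurable _ (cut_space T)).
pose nu : {measure set Z -> \bar R} := measure_extension mu.
have nuE D : small_clopen D -> nu D = (lam D)%:E.
  by move=> sD; rewrite /nu /= /measure_extension measurable_mu_extE // muE.
have mZ D : small_clopen D -> measurable (D : set Z).
  by move=> sD; exact: sub_sigma_algebra.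
have f_ x : {f : LspaceType1 nu | (f : Z -> R) = \1_(cut_at x) %[ae nu]}.
  apply: cid; apply: indicator_in_L1; first exact: mZ.
  by rewrite nuE // ltry.
pose f x := sval (f_ x); pose rho x y := lam (cut_symdiff x y).
exists _, Z, nu, f, rho; split.
- split => [x y|x|x y|x y z].
  + exact: limit_content_ge0.
  + rewrite /rho (_ : cut_symdiff x x = set0); first by rewrite /lam limit_content0.
    by rewrite eqEsubset; split => // A /cut_symdiffP.
  + rewrite /rho; congr lam; rewrite eqEsubset.
    by split => A /cut_symdiffP/nesym ?; apply/cut_symdiffP.
  + rewrite -lee_fin EFinD -!muE.
    apply: (@le_trans _ _ (mu (cut_symdiff x y `|` cut_symdiff y z))); last first.
      by apply: measureU2; exact: small_sd.
    apply: le_measure; rewrite ?inE /=; first exact: small_sd.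
      by apply: small_clopenU; exact: small_sd.
    move=> A /cut_symdiffP xz.
    have [xy|xy] := pselect (A x = A y); last by left; apply/cut_symdiffP.
    by right; apply/cut_symdiffP; rewrite -xy.
- move=> x y; rewrite (@L1_dist_indicators _ Z _ _ (cut_at x) (cut_at y)).
  + exact: nuE (small_sd x y).
  + exact: mZ.
  + exact: mZ.
  + by rewrite /f; case: (f_ x).
  + by rewrite /f; case: (f_ y).
- move=> x y a b /UC Uab.
  have cv : N s (cut_symdiff x y) @[s --> U] --> rho x y by apply: limit_content_cvg.
  apply/andP; split.
  + by apply: (cvgr_to_ge cv); apply: filterS Uab => s /= /andP[].
  + by apply: (cvgr_to_le cv); apply: filterS Uab => s /= /andP[].
Qed.

(** * Independent draws *)

Section ProductLaw.
Context (R : realType) (C : Type) (c0 : C) (law : seq (R * C)).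
Hypothesis law_weighted : weighted law.
Hypothesis law_total : mean law (fun=> 1) = 1.

(** [n] independent draws from [law], as a function of the draw number; the
values beyond [n] are the default [c0]. *)
Fixpoint iid (n : nat) : seq (R * (nat -> C)) :=
  if n is n'.+1 then
    bind law (fun c =>
      [seq (p.1, fun i => if i is i'.+1 then p.2 i' else c) | p <- iid n'])
  else [:: (1, fun=> c0)].

Lemma iid_weighted n : weighted (iid n).
Proof.
elim: n => [|n IH] /=; first by rewrite /weighted /= ler01.
apply: weighted_bind => // c.
exact: (weighted_map (fun (g : nat -> C) i => if i is i'.+1 then g i' else c)).
Qed.

Lemma mean_iidS n (F : (nat -> C) -> R) : mean (iid n.+1) F =
  mean law (fun c =>
    mean (iid n) (fun g => F (fun i => if i is i'.+1 then g i' else c))).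
Proof.
rewrite mean_bind; congr mean; apply/funext => c.
by rewrite (mean_map (fun (g : nat -> C) i => if i is i'.+1 then g i' else c)).
Qed.

Lemma mean_const (A : Type) (mu : seq (R * A)) (c : R) :
  mean mu (fun=> c) = c * mean mu (fun=> 1).
Proof. by rewrite -meanZ; congr mean; apply/funext => a; rewrite mulr1. Qed.

Lemma iid_total n : mean (iid n) (fun=> 1) = 1.
Proof.
elim: n => [|n IH]; first by rewrite /mean big_seq1 mulr1.
by rewrite mean_iidS IH.
Qed.

Lemma mean_iid n i (f : C -> R) : (i < n)%N ->
  mean (iid n) (fun g => f (g i)) = mean law f.
Proof.
elim: n i => // n IH [|i] ltin; rewrite mean_iidS.
  by congr mean; apply/funext => c; rewrite mean_const iid_total mulr1.
under [X in mean law X]funext => c do rewrite IH //.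
by rewrite mean_const law_total mulr1.
Qed.

Lemma mean_iid2 n i j (f g : C -> R) : (i < n)%N -> (j < n)%N -> i <> j ->
  mean (iid n) (fun w => f (w i) * g (w j)) = mean law f * mean law g.
Proof.
elim: n i j => // n IH [|i] [|j] // ltin ltjn ij; rewrite mean_iidS.
- under [X in mean law X]funext => c do rewrite meanZ mean_iid // mulrC.
  by rewrite meanZ mulrC.
- under [X in mean law X]funext => c do
    (under [X in mean _ X]funext => w do rewrite mulrC; rewrite meanZ mean_iid // mulrC).
  by rewrite meanZ.
have ij' : i <> j by move=> e; apply: ij; rewrite e.
under [X in mean law X]funext => c do rewrite IH //.
by rewrite mean_const law_total mulr1.
Qed.

End ProductLaw.

(** * The laws of the random choices *)

(** The state of a vertex with respect to a partially constructed cut: decided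
([below] or [above]), or still lying [on] the slice. *)
Inductive side := below | on | above.

Definition opposite (s : side) : side :=
  match s with below => above | on => on | above => below end.

Section CutLaw.
Context (R : realType) (m : nat).
Hypothesis m_ge2 : (2 <= m)%N.

(** Thresholds are counted in half units along an edge cut into [m] pieces: the
even value [2 * k] is the [k]-th dividing point, the odd value [2 * k + 1] the
open piece that follows it.  The weights are forced by [slicing_step]: with mass
[M / m] for a vertex to be [on] and [M * (m - 1) / m] for an edge to go from
[below] to [above], the same proportions must reappear at the finer level, where
[M] is divided by [m].  The two extreme pieces get half the weight of the others
because they also receive cuts that pass through an end of the edge. *)
Definition threshold_law : seq (R * nat) :=
  [:: ((2 * m%:R)^-1, 1%N); ((2 * m%:R)^-1, (2 * m).-1)] ++
  [seq (m%:R^-1, (2 * k).+1) | k <- iota 1 (m - 2)] ++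
  [seq ((m%:R * m.-1%:R)^-1, (2 * k)%N) | k <- iota 1 m.-1].

(** The side drawn by a vertex that lies above a vertex of the slice; it stays
undecided with the probability [1 / m] by which masses shrink per level. *)
Definition side_law : seq (R * side) :=
  [:: (m.-1%:R / (2 * m%:R), below); (m%:R^-1, on);
      (m.-1%:R / (2 * m%:R), above)].

Definition choice_law : seq (R * (nat * side)) :=
  bind threshold_law (fun t => [seq (p.1, (t, p.2)) | p <- side_law]).

Let m_gt0 : 0 < m%:R :> R. Proof. by rewrite ltr0n; lia. Qed.
Let pm_gt0 : 0 < m.-1%:R :> R. Proof. by rewrite ltr0n; lia. Qed.
Let pmE : m.-1%:R = m%:R - 1 :> R.
Proof. by rewrite -subn1 natrB //; lia. Qed.

Lemma mass_const_seq (c : R) (s : seq nat) (f : nat -> nat) (P : nat -> Prop) :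
  mass [seq (c, f k) | k <- s] P = c * \sum_(k <- s) ind R (P (f k)).
Proof. by rewrite /mass /mean big_map big_distrr. Qed.

Lemma mass_cat (A : Type) (mu nu : seq (R * A)) P :
  mass (mu ++ nu) P = mass mu P + mass nu P.
Proof. by rewrite /mass /mean big_cat. Qed.

Lemma sum_ind_unique (a n k0 : nat) (P : nat -> Prop) :
  (a <= k0 < a + n)%N -> (forall k, P k <-> k = k0) ->
  \sum_(k <- iota a n) ind R (P k) = 1.
Proof.
move=> k0in PE; rewrite (bigD1_seq k0) ?iota_uniq ?mem_iota //=.
rewrite ind_true ?PE // big1 ?addr0 // => k /eqP kk0.
by rewrite ind_false // PE.
Qed.

Lemma sum_ind_none (s : seq nat) (P : nat -> Prop) :
  (forall k, k \in s -> ~ P k) -> \sum_(k <- s) ind R (P k) = 0.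
Proof. by move=> nP; rewrite big_seq big1 // => k /nP ?; rewrite ind_false. Qed.

Lemma threshold_weighted : weighted threshold_law.
Proof.
rewrite /weighted /threshold_law /= !invr_ge0 !mulr_ge0 ?ltW //=.
rewrite all_cat !all_map; apply/andP; split; apply/allP => k _ /=.
  by rewrite invr_ge0 ltW.
by rewrite invr_ge0 mulr_ge0 ?ltW.
Qed.

Lemma side_weighted : weighted side_law.
Proof.
rewrite /weighted /= invr_ge0 (ltW m_gt0) andbT /=.
by rewrite divr_ge0 ?mulr_ge0 ?ltW.
Qed.

Lemma choice_weighted : weighted choice_law.
Proof.
apply: weighted_bind; first exact: threshold_weighted.
by move=> t; apply: (weighted_map (fun s => (t, s))); exact: side_weighted.
Qed.

Lemma threshold_total : mean threshold_law (fun=> 1) = 1.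
Proof.
have -> : mean threshold_law (fun=> 1) = mass threshold_law (fun=> True).
  by congr mean; apply/funext => t; rewrite ind_true.
have sumT (n : nat) : \sum_(k <- iota 1 n) ind R True = n%:R.
  rewrite (eq_bigr (fun=> 1)) => [|k _]; last by rewrite ind_true.
  by rewrite big_const_seq count_predT size_iota iter_addr_0.
rewrite /threshold_law !mass_cat !mass_const_seq !sumT.
rewrite /mass /mean !big_cons big_nil /= !ind_true //.
rewrite natrB // pmE; field.
by apply/andP; split; [rewrite -pmE|]; rewrite gt_eqF.
Qed.

Lemma side_total : mean side_law (fun=> 1) = 1.
Proof.
rewrite /mean !big_cons big_nil /= pmE; field.
by rewrite gt_eqF.
Qed.

Lemma mean_choice F :
  mean choice_law F = mean threshold_law (fun t => mean side_law (fun s => F (t, s))).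
Proof.
by rewrite mean_bind; congr mean; apply/funext => t; rewrite (mean_map (fun s => (t, s))).
Qed.

Lemma choice_total : mean choice_law (fun=> 1) = 1.
Proof. by rewrite mean_choice side_total threshold_total. Qed.

Lemma mass_choice_threshold (P : nat -> Prop) :
  mass choice_law (fun c => P c.1) = mass threshold_law P.
Proof.
rewrite /mass mean_choice; congr mean; apply/funext => t /=.
by rewrite mean_const side_total mulr1.
Qed.

Lemma mass_choice_side (P : side -> Prop) :
  mass choice_law (fun c => P c.2) = mass side_law P.
Proof.
by rewrite /mass mean_choice /= mean_const threshold_total mulr1.
Qed.

Lemma ind_nat (a b : nat) : ind R (a = b) = (a == b)%:R.
Proof. by case: eqP => ab; rewrite ?(ind_true _ ab) ?(ind_false _ ab). Qed.

Lemma ind_side (s t : side) : ind R (s = t) =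
  match s, t with
  | below, below | on, on | above, above => 1
  | _, _ => 0
  end.
Proof. by case: s; case: t; (by rewrite ind_true) || (by rewrite ind_false). Qed.

Lemma mass_side_end s : s <> on ->
  mass choice_law (fun c => c.2 = s) = m.-1%:R / (2 * m%:R).
Proof.
move=> ns; rewrite (mass_choice_side (fun t => t = s)).
rewrite /mass /mean !big_cons big_nil /=.
by rewrite !ind_side; case: s ns => // _; rewrite ?mulr1 ?mulr0 ?addr0 ?add0r.
Qed.

Lemma mass_side_on : mass choice_law (fun c => c.2 = on) = m%:R^-1.
Proof.
rewrite (mass_choice_side (fun t => t = on)).
rewrite /mass /mean !big_cons big_nil /=.
by rewrite !ind_side ?mulr1 ?mulr0 ?addr0 ?add0r.
Qed.

Lemma mass_threshold_end t : t = 1%N \/ t = (2 * m).-1 ->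
  mass choice_law (fun c => c.1 = t) = (2 * m%:R)^-1.
Proof.
move=> tE; rewrite (mass_choice_threshold (fun u => u = t)).
rewrite /threshold_law !mass_cat !mass_const_seq !sum_ind_none; first last.
- by move=> k; rewrite mem_iota; lia.
- by move=> k; rewrite mem_iota; lia.
rewrite /mass /mean !big_cons big_nil /=.
have ne : (1 == (2 * m).-1)%N = false by apply/eqP; lia.
rewrite !ind_nat; case: tE => ->; rewrite eqxx ?ne 1?eq_sym ?ne.
  by rewrite mulr1 !mulr0 !addr0.
by rewrite mulr1 !mulr0 !addr0 add0r.
Qed.

Lemma threshold_supported : supported (fun t => 0 < t < 2 * m)%N threshold_law.
Proof.
rewrite /supported /threshold_law /= !asboolb all_cat !all_map.
apply/and4P; split; first [by lia | by apply/allP => k; rewrite mem_iota /= asboolb; lia].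
Qed.

Lemma mass_threshold_first :
  mass choice_law (fun c => (c.1 < 2)%N) = (2 * m%:R)^-1.
Proof.
rewrite -(@mass_threshold_end 1%N); last by left.
rewrite (mass_choice_threshold (fun t => t < 2)%N).
rewrite (mass_choice_threshold (fun t => t = 1%N)).
apply: (eq_mean threshold_supported) => t tin; apply: ind_iff.
by split; lia.
Qed.

Lemma mass_threshold_last :
  mass choice_law (fun c => (2 * m.-1 < c.1)%N) = (2 * m%:R)^-1.
Proof.
rewrite -(@mass_threshold_end (2 * m).-1); last by right.
rewrite (mass_choice_threshold (fun t => 2 * m.-1 < t)%N).
rewrite (mass_choice_threshold (fun t => t = (2 * m).-1)).
apply: (eq_mean threshold_supported) => t tin; apply: ind_iff.
by split; lia.
Qed.

Lemma mass_threshold_gap k : (0 < k < m.-1)%N ->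
  mass choice_law (fun c => c.1 = (2 * k).+1) = m%:R^-1.
Proof.
move=> kin; rewrite (mass_choice_threshold (fun u => u = (2 * k).+1)).
rewrite /threshold_law !mass_cat !mass_const_seq.
rewrite (@sum_ind_unique 1 (m - 2) k); [|lia|by move=> ?; lia].
rewrite sum_ind_none; last by move=> ? _; lia.
rewrite /mass /mean !big_cons big_nil /=.
by rewrite !ind_false ?mulr1 ?mulr0 ?addr0 ?add0r //; lia.
Qed.

Lemma mass_threshold_node k : (0 < k < m)%N ->
  mass choice_law (fun c => c.1 = (2 * k)%N) = (m%:R * m.-1%:R)^-1.
Proof.
move=> kin; rewrite (mass_choice_threshold (fun u => u = (2 * k)%N)).
rewrite /threshold_law !mass_cat !mass_const_seq.
rewrite sum_ind_none; last by move=> ? _; lia.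
rewrite (@sum_ind_unique 1 m.-1 k); [|lia|by move=> ?; lia].
rewrite /mass /mean !big_cons big_nil /=.
by rewrite !ind_false ?mulr1 ?mulr0 ?addr0 ?add0r //; lia.
Qed.

(** [1 / (2 m)] is the least probability among the draws used for steering: the
two extreme thresholds, and each of the two decided sides. *)
Definition likely (A : nat * side -> Prop) := (2 * m%:R)^-1 <= mass choice_law A.

Lemma likely_side s : s <> on -> likely (fun c => c.2 = s).
Proof.
move=> ns; rewrite /likely mass_side_end //; apply: ler_peMl.
  by rewrite invr_ge0 mulr_ge0 ?ltW.
by rewrite ler1n; lia.
Qed.

Lemma likely_threshold t : t = 1%N \/ t = (2 * m).-1 -> likely (fun c => c.1 = t).
Proof. by move=> tE; rewrite /likely mass_threshold_end. Qed.

End CutLaw.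

(** * Cells and the refinement of a three-valued cut *)

(** The open cell of the realization that contains a point.  All estimates depend
on points through their cells only. *)
Definition cell (X : digraph) : Type := (vertex X + edge X)%type.

Definition touches (X : digraph) (c : cell X) (v : vertex X) : Prop :=
  match c with
  | inl u => u = v
  | inr e => source e = v \/ target e = v
  end.

Definition near (X : digraph) (c c' : cell X) : Prop :=
  exists v, touches c v /\ touches c' v.

Definition in_star (X : digraph) (v : vertex X) (c : cell X) : Prop :=
  c = inl v \/ exists2 e, touches (inr e) v &
    [\/ c = inr e, c = inl (source e) | c = inl (target e)].

(** The cell of the image of a point, as computed by [cell_unsubdivide]: a new
subdivision vertex, and a piece of an edge, both lie in the open edge. *)
Definition parent (m : nat) (Y X : digraph) (h : digraph_hom Y (subdivision m X))
    (c : cell Y) : cell X :=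
  match c with
  | inl w => match hom_vertex h w with inl v => inl v | inr (e, _) => inr e end
  | inr e => inr (hom_edge h e).1
  end.

Section CutVertex.
Context (m : nat) (X : digraph).
Hypothesis m_ge2 : (2 <= m)%N.
Implicit Types (e : edge X).

Lemma cut_vertex_target e : cut_vertex m e m = inl (target e).
Proof. by case: m m_ge2 => // n _; rewrite /= insubN // -leqNgt. Qed.

Lemma cut_vertex_inner e k : (0 < k < m)%N ->
  exists2 i : 'I_m.-1, i.+1 = k & cut_vertex m e k = inr (e, i).
Proof.
case: k => // k /= km; have km' : (k < m.-1)%N by lia.
by exists (Ordinal km') => //=; rewrite insubT.
Qed.

Lemma cut_vertex_inl e k v : (k <= m)%N -> cut_vertex m e k = inl v ->
  (k = 0%N /\ v = source e) \/ (k = m /\ v = target e).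
Proof.
move=> km; case: (posnP k) => [->|k0] /=; first by case=> ->; left.
case: (ltngtP k m) km => // [km|->] _.
  by have [|i _ ->] := @cut_vertex_inner e k; rewrite ?k0.
by rewrite cut_vertex_target => -[->]; right.
Qed.

Lemma cut_vertex_inr e e' k i : (k <= m)%N -> cut_vertex m e k = inr (e', i) ->
  e' = e /\ k = i.+1.
Proof.
move=> km; case: (posnP k) => [->//|k0].
case: (ltngtP k m) km => // [km|->] _; last by rewrite cut_vertex_target.
by have [|j <- ->] := @cut_vertex_inner e k; rewrite ?k0 // => -[<- ->].
Qed.

End CutVertex.

Definition threshold (t k : nat) : side :=
  if (2 * k < t)%N then below else if (2 * k == t)%N then on else above.

(** The side of the [k]-th dividing point of an edge with ends on the sides [a]
and [b].  Only an edge that crosses the cut completely uses its threshold; if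
one end is [on], the slice has been placed there and the interior of the edge
takes the side of the other end. *)
Definition inner_side (a b : side) (t k : nat) : side :=
  match a with
  | below => match b with above => threshold t k | _ => below end
  | _ => above
  end.

Definition resolve (s r : side) : side := match s with on => r | _ => s end.

Definition refine_at (m : nat) (X : digraph) (S : vertex X -> side)
    (T : edge X -> nat) (r : side) (x : vertex (subdivision m X)) : side :=
  match x with
  | inl v => resolve (S v) r
  | inr (e, i) => inner_side (S (source e)) (S (target e)) (T e) i.+1
  end.

Section Refine.
Context (m : nat) (Y X : digraph) (h : digraph_hom Y (subdivision m X)).
Hypothesis m_ge2 : (2 <= m)%N.
Context (col : vertex Y + edge X -> nat).
Implicit Types (S : vertex X -> side) (w : nat -> nat * side).

(** One refinement of a cut.  A colouring [col] tells which of the independent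
draws [w] is used by each new vertex and by each old edge.  An edge uses a single
threshold for all edges above it, which keeps the refined cut ordered. *)
Definition refine S w : vertex Y -> side := fun y =>
  refine_at S (fun e => (w (col (inr e))).1) (w (col (inl y))).2 (hom_vertex h y).

(** Along an edge the sides never decrease and are not both [on]: the five
patterns allowed are those with lower end [below] or upper end [above]. *)
Definition ordered S (e : edge X) : Prop :=
  S (source e) = below \/ S (target e) = above.

Lemma refine_cut S w e k r : (k <= m)%N ->
  refine_at S (fun e => (w (col (inr e))).1) r (cut_vertex m e k) =
  if k == 0%N then resolve (S (source e)) r
  else if k == m then resolve (S (target e)) r
  else inner_side (S (source e)) (S (target e)) (w (col (inr e))).1 k.
Proof.
move=> km; case: eqP => [->//|/eqP k0]; case: eqP => [->|/eqP kNm].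
  by rewrite cut_vertex_target.
have [|i <- -> //] := @cut_vertex_inner m X m_ge2 e k.
by rewrite lt0n k0 ltn_neqAle kNm km.
Qed.

Lemma refine_source S w (f : edge Y) e (k : 'I_m) : hom_edge h f = (e, k) ->
  refine S w (source f) =
  if k == 0%N :> nat then resolve (S (source e)) (w (col (inl (source f)))).2
  else inner_side (S (source e)) (S (target e)) (w (col (inr e))).1 k.
Proof.
move=> hf; rewrite /refine -(hom_source h) hf /= refine_cut; last exact: ltnW.
by case: eqP => // _; case: eqP => // km; have := ltn_ord k; rewrite {1}km ltnn.
Qed.

Lemma refine_target S w (f : edge Y) e (k : 'I_m) : hom_edge h f = (e, k) ->
  refine S w (target f) =
  if k.+1 == m then resolve (S (target e)) (w (col (inl (target f)))).2
  else inner_side (S (source e)) (S (target e)) (w (col (inr e))).1 k.+1.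
Proof.
by move=> hf; rewrite /refine -(hom_target h) hf; exact: (@refine_cut _ _ _ k.+1).
Qed.

End Refine.

(** * The refinement step preserves the masses *)

(** The stationary description of a random cut at the level where edges have
length [M]; [GV] and [GE] single out the part of the graph on which it is
claimed. *)
Definition slicing (R : realType) (m : nat) (X : digraph) (M : R)
    (GV : vertex X -> Prop) (GE : edge X -> Prop)
    (mu : seq (R * (vertex X -> side))) : Prop :=
  [/\ weighted mu,
      supported (fun S => forall e, GE e -> ordered S e) mu,
      forall v, GV v -> mass mu (fun S => S v = on) = M / m%:R &
      forall e, GE e ->
        mass mu (fun S => S (source e) = below /\ S (target e) = above) =
        M * m.-1%:R / m%:R].

Section Step.
Context (R : realType) (m : nat) (Y X : digraph).
Context (h : digraph_hom Y (subdivision m X)).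
Hypothesis m_ge2 : (2 <= m)%N.
Context (col : vertex Y + edge X -> nat) (n : nat).
Hypothesis col_lt : forall key, (col key < n)%N.
Implicit Types (S : vertex X -> side) (w : nat -> nat * side).

Definition colourings := iid (0%N, on) (choice_law R m) n.

Definition step S : seq (R * (vertex Y -> side)) :=
  [seq (p.1, refine h col S p.2) | p <- colourings].

Let choice_w : weighted (choice_law R m). Proof. exact: choice_weighted. Qed.
Let choice_t : mean (choice_law R m) (fun=> 1) = 1. Proof. exact: choice_total. Qed.

Lemma mass_step S Q :
  mass (step S) Q = mass colourings (fun w => Q (refine h col S w)).
Proof. exact: (mean_map (refine h col S)). Qed.

(** An event decided by a single draw has the probability of that draw, whatever
the colouring. *)
Lemma mass_step_key S Q key P :
  (forall w, Q (refine h col S w) <-> P (w (col key))) ->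
  mass (step S) Q = mass (choice_law R m) P.
Proof.
move=> QP; rewrite mass_step (eq_mass _ QP).
exact: (mean_iid _ choice_t (fun c => ind R (P c)) (col_lt key)).
Qed.

Lemma mass_step_true S (Q : (vertex Y -> side) -> Prop) :
  (forall w, Q (refine h col S w)) -> mass (step S) Q = 1.
Proof.
move=> QT; rewrite mass_step -[RHS](iid_total (0%N, on) choice_t n).
by congr mean; apply/funext => w; rewrite ind_true.
Qed.

Lemma mass_step_false S (Q : (vertex Y -> side) -> Prop) :
  (forall w, ~ Q (refine h col S w)) -> mass (step S) Q = 0.
Proof.
move=> QF; rewrite mass_step /mass /mean big1 // => p _.
by rewrite ind_false ?mulr0.
Qed.

Lemma weighted_step S : weighted (step S).
Proof. by apply: weighted_map; exact: iid_weighted. Qed.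

Let m_gt0 : 0 < m%:R :> R. Proof. by rewrite ltr0n; lia. Qed.
Let pm_gt0 : 0 < m.-1%:R :> R. Proof. by rewrite ltr0n; lia. Qed.

Lemma step_vertex S y v : hom_vertex h y = inl v ->
  mass (step S) (fun U => U y = on) = m%:R^-1 * ind R (S v = on).
Proof.
move=> hy; have rE w : refine h col S w y = resolve (S v) (w (col (inl y))).2.
  by rewrite /refine hy.
case Sv: (S v).
- by rewrite mass_step_false ?ind_false ?mulr0 // => w; rewrite rE Sv.
- rewrite (mass_step_key (key := inl y) (P := fun c => c.2 = on)).
    by rewrite mass_side_on // ind_true ?mulr1.
  by move=> w; rewrite rE Sv.
- by rewrite mass_step_false ?ind_false ?mulr0 // => w; rewrite rE Sv.
Qed.

Lemma thresholdP t k : threshold t k = on <-> t = (2 * k)%N.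
Proof. by rewrite /threshold; case: ltngtP => //; split => //; lia. Qed.

Lemma step_inner_vertex S y e i : hom_vertex h y = inr (e, i) -> ordered S e ->
  mass (step S) (fun U => U y = on) =
  (m%:R * m.-1%:R)^-1 * ind R (S (source e) = below /\ S (target e) = above).
Proof.
move=> hy oS.
have rE w : refine h col S w y =
    inner_side (S (source e)) (S (target e)) (w (col (inr e))).1 i.+1.
  by rewrite /refine hy.
have [[sb ta]|nba] := pselect (S (source e) = below /\ S (target e) = above).
  rewrite (mass_step_key (key := inr e) (P := fun c => c.1 = (2 * i.+1)%N)).
    rewrite mass_threshold_node ?ind_true ?mulr1 //.
    by have := ltn_ord i; lia.
  by move=> w; rewrite rE sb ta /=; exact: thresholdP.
rewrite mass_step_false ?ind_false ?mulr0 // => w; rewrite rE.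
by case: oS nba => ->; [case: (S (target e))|case: (S (source e))] => //= -[].
Qed.

Lemma step_edge S f e (k : 'I_m) : hom_edge h f = (e, k) -> ordered S e ->
  mass (step S) (fun U => U (source f) = below /\ U (target f) = above) =
  (if (k == 0%N :> nat) || (k.+1 == m) then (2 * m%:R)^-1 else m%:R^-1) *
    ind R (S (source e) = below /\ S (target e) = above) +
  m.-1%:R / (2 * m%:R) *
    ((k == 0%N :> nat)%:R * ind R (S (source e) = on) +
     (k.+1 == m)%:R * ind R (S (target e) = on)).
Proof.
move=> hf oS.
have sE w := refine_source m_ge2 col S w hf.
have tE w := refine_target m_ge2 col S w hf.
have km := ltn_ord k.
have [[sb ta]|nba] := pselect (S (source e) = below /\ S (target e) = above).
  rewrite (ind_true _ (conj sb ta)) mulr1 !(@ind_false _ (_ = on)) ?sb ?ta //.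
  rewrite !mulr0 addr0 mulr0 addr0.
  case: (eqVneq (k : nat) 0%N) => [k0|k0] /=.
    rewrite -mass_threshold_first //; apply: (mass_step_key (key := inr e)) => w.
    rewrite sE tE sb ta k0 /= /threshold; case: eqP => [m1|_]; first by lia.
    by do ?case: ltngtP => ?; split => //; first [by case | lia].
  case: (eqVneq k.+1 m) => [k1|k1] /=.
    rewrite -mass_threshold_last //; apply: (mass_step_key (key := inr e)) => w.
    rewrite sE tE sb ta k1 eqxx (negbTE k0) /= /threshold.
    by do ?case: ltngtP => ?; split => //; first [by case | lia].
  rewrite -(@mass_threshold_gap _ _ m_ge2 k); last by lia.
  apply: (mass_step_key (key := inr e)) => w.
  rewrite sE tE sb ta (negbTE k0) (negbTE k1) /= /threshold.
  by do ?case: ltngtP => ?; split => //; first [by case | lia].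
rewrite (ind_false _ nba) mulr0 add0r.
have mE := mass_side_end R m_ge2.
case: (eqVneq (k : nat) 0%N) => [k0|k0].
  have -> : (k.+1 == m) = false by rewrite k0; apply/eqP; lia.
  rewrite mul1r mul0r addr0.
  have [son|nson] := pselect (S (source e) = on).
    rewrite (ind_true _ son) mulr1 -(mE below) //.
    apply: (mass_step_key (key := inl (source f))) => w.
    rewrite sE tE k0 /= son /=; case: eqP => [m1|_]; first by lia.
    by split => [[]|].
  rewrite (ind_false _ nson) mulr0 mass_step_false // => w.
  rewrite sE tE k0 /=; case: eqP => [m1|_]; first by lia.
  move: oS nba nson; rewrite /ordered.
  by case: (S (source e)); case: (S (target e)) => //= -[]// _ nba _ [] // _ _; apply: nba.
rewrite mul0r add0r; case: (eqVneq k.+1 m) => [k1|k1].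
  rewrite mul1r; have [ton|nton] := pselect (S (target e) = on).
    rewrite (ind_true _ ton) mulr1 -(mE above) //.
    apply: (mass_step_key (key := inl (target f))) => w.
    rewrite sE tE (negbTE k0) k1 eqxx ton.
    case: oS => [->|]; last by rewrite ton.
    by split => [[]|].
  rewrite (ind_false _ nton) mulr0 mass_step_false // => w.
  rewrite sE tE (negbTE k0) k1 eqxx.
  move: oS nba nton; rewrite /ordered.
  by case: (S (source e)); case: (S (target e)) => //= -[]// _ nba _ [] // _ _; apply: nba.
rewrite mul0r mulr0 mass_step_false // => w.
rewrite sE tE (negbTE k0) (negbTE k1).
move: oS nba; rewrite /ordered.
by case: (S (source e)); case: (S (target e)) => //= -[]// _ nba [] // _ _; apply: nba.
Qed.

(** Along an ordered edge a common threshold yields a nondecreasing sequence of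
sides, and two consecutive dividing points cannot both meet it. *)
Lemma refine_ordered S w f : ordered S (hom_edge h f).1 ->
  ordered (refine h col S w) f.
Proof.
case hf: (hom_edge h f) => [e k] /= oS; rewrite /ordered.
rewrite (refine_source m_ge2 col S w hf) (refine_target m_ge2 col S w hf).
have km := ltn_ord k.
move: oS; rewrite /ordered.
case: (S (source e)) => -[] // sE; rewrite ?sE //=.
- case: eqP => k0; first by left.
  case: (S (target e)); [by left | by left |].
  case: eqP => k1; first by right.
  rewrite /threshold; have [lt|ge] := ltnP (2 * k) (w (col (inr e))).1; first by left.
  right; have -> : (2 * k.+1 < (w (col (inr e))).1)%N = false by lia.
  by have -> : (2 * k.+1 == (w (col (inr e))).1)%N = false by lia.
- case: eqP => k0; first by left.
  case: eqP => k1; first by right.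
  rewrite /threshold; have [lt|ge] := ltnP (2 * k) (w (col (inr e))).1; first by left.
  right; have -> : (2 * k.+1 < (w (col (inr e))).1)%N = false by lia.
  by have -> : (2 * k.+1 == (w (col (inr e))).1)%N = false by lia.
- by right; case: eqP.
- by right; case: eqP.
Qed.

(** Conditionally on the coarse cut each event depends on one draw, so the new
masses are linear in the old ones, and the weights of [threshold_law] and
[side_law] solve the resulting equations. *)
Lemma slicing_step (M : R) GV GE mu :
  (forall e, GE e -> GV (source e) /\ GV (target e)) ->
  slicing m M GV GE mu ->
  slicing m (M / m%:R)
    (fun y => match hom_vertex h y with inl v => GV v | inr (e, _) => GE e end)
    (fun f => GE (hom_edge h f).1) (bind mu step).
Proof.
move=> GEV [wmu omu von eba]; split.
- by apply: weighted_bind => // S; exact: weighted_step.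
- apply: (supported_bind omu) => S oS; apply: supported_map => w f GEf.
  by apply: refine_ordered; exact: oS.
- move=> y; case hy: (hom_vertex h y) => [v|[e i]] G.
    rewrite /mass mean_bind (eq_mean (supportedT mu) (fun S _ => step_vertex S hy)).
    by rewrite meanZ -/(mass _ _) von // mulrC.
  rewrite /mass mean_bind (eq_mean omu (fun S oS => step_inner_vertex hy (oS e G))).
  rewrite meanZ -/(mass _ _) eba //; field.
  by rewrite !gt_eqF.
- move=> f; case hf: (hom_edge h f) => [e k] /= G.
  have [GVs GVt] := GEV e G.
  rewrite /mass mean_bind (eq_mean omu (fun S oS => step_edge hf (oS e G))).
  rewrite meanD !meanZ meanD !meanZ -!/(mass _ _) eba // !von //.
  have pmE : m.-1%:R = m%:R - 1 :> R by rewrite -subn1 natrB //; lia.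
  case: (eqVneq (k : nat) 0%N) => [k0|k0] /=.
    have -> : (k.+1 == m) = false by rewrite k0; apply/eqP; lia.
    rewrite mul1r mul0r pmE; field; by rewrite gt_eqF.
  rewrite mul0r; case: (eqVneq k.+1 m) => _ /=; rewrite ?mul1r ?mul0r pmE.
    by field; rewrite gt_eqF.
  by field; rewrite gt_eqF.
Qed.

End Step.

(** * Points that have settled on one side *)

Lemma threshold_first k : (0 < k)%N -> threshold 1 k = above.
Proof. by rewrite /threshold => k0; case: ltngtP => // ?; exfalso; lia. Qed.

Lemma threshold_last m k : (k < m)%N -> threshold (2 * m).-1 k = below.
Proof. by rewrite /threshold => km; rewrite ifT //; lia. Qed.

(** A cell whose ends lie on the same decided side will not be separated by any
later refinement. *)
Definition constant (X : digraph) (s : side) (S : vertex X -> side) (c : cell X) :=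
  forall v, touches c v -> S v = s.

Lemma constant_vertex (X : digraph) s (S : vertex X -> side) y : constant s S (inl y) <-> S y = s.
Proof. by split=> [|Sy v <-//]; exact. Qed.

Section Settle.
Context (R : realType) (m : nat) (Y X : digraph).
Context (h : digraph_hom Y (subdivision m X)).
Hypothesis m_ge2 : (2 <= m)%N.
Context (col : vertex Y + edge X -> nat).
Implicit Types (c : cell Y) (S : vertex X -> side) (w : nat -> nat * side).

Definition ordered_on S (c : cell X) := forall e, c = inr e -> ordered S e.

(** The draws on which the fate of a cell depends during one step. *)
Definition is_key c (key : vertex Y + edge X) : Prop :=
  match key with
  | inl y => touches c y /\ exists v, hom_vertex h y = inl v
  | inr e => parent h c = inr e
  end.

Lemma hom_edge_end f e k v : hom_edge h f = (e, k) ->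
  (hom_vertex h (source f) = inl v -> k = 0%N :> nat /\ v = source e) /\
  (hom_vertex h (target f) = inl v -> k.+1 = m /\ v = target e).
Proof.
move=> hf; rewrite -(hom_source h) -(hom_target h) hf; have km := ltn_ord k.
split=> /(cut_vertex_inl m_ge2) H.
  have [//|[k0 _]] := H (ltnW km).
  by move: km; rewrite k0 ltnn.
by have [[]|] := H km.
Qed.

Lemma touches_parent c y v :
  touches c y -> hom_vertex h y = inl v -> touches (parent h c) v.
Proof.
case: c => [u|f] /=; first by move=> -> ->.
case hf: (hom_edge h f) => [e k]; have [hs ht] := hom_edge_end v hf.
by case=> <- /[dup] hy; [move/hs => [_ ->]; left | move/ht => [_ ->]; right].
Qed.

Lemma parent_inner c y e i :
  touches c y -> hom_vertex h y = inr (e, i) -> parent h c = inr e.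
Proof.
case: c => [u|f] /=; first by move=> -> ->.
case hf: (hom_edge h f) => [e' k] /= fy; have km := ltn_ord k => hy; congr inr.
case: fy hy => <-; rewrite -?(hom_source h) -?(hom_target h) hf => /(cut_vertex_inr m_ge2).
  by case=> //; exact: ltnW.
by case.
Qed.

(** Hence cells whose parents share no vertex depend on different draws. *)
Lemma key_near c c' key : is_key c key -> is_key c' key ->
  near (parent h c) (parent h c').
Proof.
case: key => [y|e] /=; last first.
  by move=> -> ->; exists (source e); split; left.
move=> [cy [v yv]] [c'y _]; exists v.
by split; apply: touches_parent yv.
Qed.

Lemma constant_refine s S w c : s <> on ->
  constant s S (parent h c) -> constant s (refine h col S w) c.
Proof.
move=> ns cst y cy; rewrite /refine.
case hy: (hom_vertex h y) => [v|[e i]] /=.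
  by rewrite (cst v (touches_parent cy hy)); case: s ns {cst}.
have ce := parent_inner cy hy.
rewrite ce in cst; rewrite (cst (source e)) ?(cst (target e)) /=; try by [left|right].
by case: s ns {cst}.
Qed.

(** In each of the possible patterns a single draw suffices to decide a cell,
though not necessarily on a side of our choice. *)
Lemma settle S c : ordered_on S (parent h c) ->
  exists key A s, [/\ is_key c key, likely R m A, s <> on &
    forall w, A (w (col key)) -> constant s (refine h col S w) c].
Proof.
have lik s : s <> on -> likely R m (fun a => a.2 = s) by exact: likely_side.
have lik1 : likely R m (fun a => a.1 = 1%N).
  by apply: likely_threshold => //; left.
have likm : likely R m (fun a => a.1 = (2 * m).-1).
  by apply: likely_threshold => //; right.
case: c => [y|f] oc.
  case hy: (hom_vertex h y) => [v|[e i]].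
    exists (inl y), (fun a => a.2 = if S v is above then above else below),
      (if S v is above then above else below).
    split; [by split=> //; exists v|by case: (S v); apply: lik|by case: (S v)|].
    move=> w Aw; apply/constant_vertex; rewrite /refine hy /=.
    by case: (S v) Aw.
  have oS : ordered S e by apply: oc; rewrite /= hy.
  exists (inr e), (fun a => a.1 = 1%N),
    (if S (source e) is below then (if S (target e) is above then above else below)
     else above).
  split; [by rewrite /= hy|by []|by case: (S _) => //; case: (S _)|].
  move=> w Aw; apply/constant_vertex; rewrite /refine hy /= Aw.
  by case: (S (source e)) => //; case: (S (target e)) => //; exact: threshold_first.
case hf: (hom_edge h f) => [e k]; have km := ltn_ord k.
have oS : ordered S e by apply: oc; rewrite /= hf.
have sE w := refine_source m_ge2 col S w hf.
have tE w := refine_target m_ge2 col S w hf.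
have cst s key A : is_key (inr f) key -> likely R m A -> s <> on ->
    (forall w, A (w (col key)) ->
      refine h col S w (source f) = s /\ refine h col S w (target f) = s) ->
    exists key A s, [/\ is_key (inr f) key, likely R m A, s <> on &
      forall w, A (w (col key)) -> constant s (refine h col S w) (inr f)].
  move=> ik lA ns H; exists key, A, s; split=> // w /H [ss st] v /= [] <- //.
have keyE : is_key (inr f) (inr e) by rewrite /= hf.
case Ss: (S (source e)).
- case St: (S (target e)).
  + apply: (cst below _ _ keyE lik1) => // w _; rewrite sE tE Ss St /=.
    by split; do ?case: ifP.
  + case: (eqVneq k.+1 m) => [k1|k1].
      have ik : is_key (inr f) (inl (target f)).
        split; first by right.
        exists (target e); rewrite -(hom_target h) hf /= -/(cut_vertex m e k.+1) k1.
        exact: cut_vertex_target.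
      apply: (cst below _ _ ik (lik below _)) => // w Aw.
      rewrite sE tE k1 eqxx Ss St /= Aw; split => //.
      by case: ifP.
    apply: (cst below _ _ keyE lik1) => // w _; rewrite sE tE Ss St (negbTE k1) /=.
    by split; do ?case: ifP.
  + case: (eqVneq (k : nat) 0%N) => [k0|k0].
      apply: (cst below _ _ keyE likm) => // w Aw; rewrite sE tE Ss St k0 /= Aw.
      split=> //; case: eqP => [m1|_]; first by lia.
      by apply: threshold_last; lia.
    apply: (cst above _ _ keyE lik1) => // w Aw; rewrite sE tE Ss St (negbTE k0) /= Aw.
    split; first by apply: threshold_first; lia.
    by case: ifP => // _; exact: threshold_first.
- have St : S (target e) = above by case: oS => [|//]; rewrite Ss.
  case: (eqVneq (k : nat) 0%N) => [k0|k0].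
    have ik : is_key (inr f) (inl (source f)).
      split; first by left.
      by exists (source e); rewrite -(hom_source h) hf /= k0.
    apply: (cst above _ _ ik (lik above _)) => // w Aw.
    by rewrite sE tE k0 /= Ss St /= Aw; split => //; case: ifP.
  apply: (cst above _ _ keyE lik1) => // w _; rewrite sE tE Ss St (negbTE k0) /=.
  by split=> //; case: ifP.
- have St : S (target e) = above by case: oS => [|//]; rewrite Ss.
  apply: (cst above _ _ keyE lik1) => // w _; rewrite sE tE Ss St /=.
  by split; do ?case: ifP.
Qed.

End Settle.

(** * Steering a point to a prescribed side *)

(** Inside an edge that crosses the cut, a point can be sent to the side [above]
by the first threshold unless it lies in the first piece, and to the side
[below] by the last threshold unless it lies in the last piece. *)
Definition wrong_end (m : nat) (Z Y : digraph) (h : digraph_hom Z (subdivision m Y))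
    (s : side) (c : cell Z) : Prop :=
  exists2 g, c = inr g &
    match s with
    | below => (hom_edge h g).2.+1 = m
    | on => True
    | above => (hom_edge h g).2 = 0%N :> nat
    end.

(** [c] can be brought to the side [s] by one draw. *)
Definition poised (m : nat) (Z Y : digraph) (h : digraph_hom Z (subdivision m Y))
    (s : side) (S : vertex Y -> side) (c : cell Z) : Prop :=
  constant s S (parent h c) \/
  exists f, [/\ parent h c = inr f, S (source f) = below, S (target f) = above &
    ~ wrong_end h s c].

Section Poised.
Context (R : realType) (m : nat).
Hypothesis m_ge2 : (2 <= m)%N.

Let lik s : s <> on -> likely R m (fun a => a.2 = s).
Proof. exact: likely_side. Qed.
Let lik1 : likely R m (fun a => a.1 = 1%N).
Proof. by apply: likely_threshold => //; left. Qed.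
Let likm : likely R m (fun a => a.1 = (2 * m).-1).
Proof. by apply: likely_threshold => //; right. Qed.

Lemma poised_settle (Z Y : digraph) (h : digraph_hom Z (subdivision m Y))
    (col : vertex Z + edge Y -> nat) (S : vertex Y -> side) (c : cell Z) s :
  s <> on -> poised h s S c ->
  exists key A, likely R m A /\
    forall w, A (w (col key)) -> constant s (refine h col S w) c.
Proof.
move=> ns [cst|[f [cf Ss St nw]]].
  have key : vertex Z + edge Y by case: c {cst} => [z|g]; left; [exact: z|exact: source g].
  exists key, (fun a => a.1 = 1%N); split=> // w _; exact: constant_refine.
exists (inr f), (fun a => a.1 = if s is above then 1%N else (2 * m).-1).
split; first by case: s ns nw.
move=> w; case: c cf nw => [z|g] /=.
  case hz: (hom_vertex h z) => [//|[e i]] [ef] _ Aw; subst e; apply/constant_vertex.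
  rewrite /refine hz /= Ss St Aw; have im := ltn_ord i.
  by case: s ns {Aw} => // _; [apply: threshold_last; lia|apply: threshold_first].
case hg: (hom_edge h g) => [e k] [ef] nw Aw; subst e; have km := ltn_ord k.
have sE := refine_source m_ge2 col S w hg.
have tE := refine_target m_ge2 col S w hg.
move: sE tE; rewrite Ss St Aw /=.
have nk : if s is above then (k != 0%N :> nat) else (k.+1 != m).
  case: s ns nw {Aw} => // _ nw; apply/eqP => k0; apply: nw; exists g; rewrite ?hg //.
case: s ns nk {nw Aw} => // _ nk sE tE v /= [] <-; rewrite ?sE ?tE ?(negbTE nk).
- by case: ifP => // _; exact: threshold_last.
- by apply: threshold_last; rewrite ltn_neqAle nk.
- by apply: threshold_first; rewrite lt0n.
- by case: ifP => // _; exact: threshold_first.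
Qed.

Context (Z Y X : digraph) (h : digraph_hom Y (subdivision m X)).
Context (h' : digraph_hom Z (subdivision m Y)).
Context (col : vertex Y + edge X -> nat).

Definition straddles (S : vertex X -> side) (e : edge X) : Prop :=
  S (source e) = below /\ S (target e) = above.

(** There is an event [Ev], of one of the two kinds whose mass is known, on which
the cell can be steered to either side within two steps.  For a point in the
interior of an edge, [Ev] is that the edge crosses the cut, and a point in
one of the two extreme pieces is reached with the help of a second threshold.
A point in the first of the [m ^ 2] pieces of two subdivisions cannot be sent
to [above] in this way; for it [Ev] is that the source of the edge is [on], and
the draw of the vertex above this source decides.  The last piece is treated
symmetrically. *)
Lemma poised_after_event (c : cell Z) :
  exists Ev : (vertex X -> side) -> Prop,
    ((exists2 v, touches (parent h (parent h' c)) v & Ev = (fun S => S v = on)) \/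
     (exists2 e, parent h (parent h' c) = inr e & Ev = straddles ^~ e)) /\
    forall S s, ordered_on S (parent h (parent h' c)) -> Ev S -> s <> on ->
      exists key A, [/\ is_key h (parent h' c) key, likely R m A &
        forall w, A (w (col key)) -> poised h' s (refine h col S w) c].
Proof.
case pc: (parent h' c) => [y|f].
  case hy: (hom_vertex h y) => [v|[e i]].
    exists (fun S => S v = on); split.
      by left; exists v; rewrite //= hy.
    move=> S s _ Sv ns; exists (inl y), (fun a => a.2 = s); split.
    - by split=> //; exists v.
    - exact: lik.
    - move=> w Aw; left; rewrite pc; apply/constant_vertex.
      by rewrite /refine hy /= Sv.
  exists (straddles ^~ e); split; first by right; exists e; rewrite //= hy.
  move=> S s _ [Ss St] ns.
  exists (inr e), (fun a => a.1 = if s is above then 1%N else (2 * m).-1); split.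
  - by rewrite /= hy.
  - by case: s ns.
  - move=> w Aw; left; rewrite pc; apply/constant_vertex.
    rewrite /refine hy /= Ss St Aw; have im := ltn_ord i.
    by case: s ns {Aw} => // _; [apply: threshold_last; lia|apply: threshold_first].
case hf: (hom_edge h f) => [e k]; have km := ltn_ord k.
have sE S w := refine_source m_ge2 col S w hf.
have tE S w := refine_target m_ge2 col S w hf.
have pE : parent h (inr f) = inr e by rewrite /= hf.
have poisedP s S : (S (source f) = s /\ S (target f) = s) \/
    [/\ S (source f) = below, S (target f) = above & ~ wrong_end h' s c] ->
    poised h' s S c.
  case=> [[ss st]|[ss st nw]]; first by left; rewrite pc => v /= [] <-.
  by right; exists f.
have oE S : ordered_on S (inr e) -> ordered S e by exact.
have wE s : s <> on -> wrong_end h' s c -> ~ wrong_end h' (opposite s) c.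
  move=> ns [g cg we] [g' cg']; move: cg' we; rewrite cg => -[<-].
  by case: s ns => //= _; lia.
have [[k0 we]|nfirst] := pselect (k = 0%N :> nat /\ wrong_end h' above c).
  exists (fun S => S (source e) = on); split.
    by left; exists (source e) => //; rewrite pE; left.
  move=> S s; rewrite pE => /oE oS Ss ns.
  have St : S (target e) = above by case: oS => [|//]; rewrite Ss.
  exists (inl (source f)), (fun a => a.2 = s); split; last first.
  - move=> w Aw; apply: poisedP.
    rewrite !sE !tE k0 Ss St /= Aw.
    case: s ns {Aw} => // _; [right|left].
      by split=> //; [case: ifP|exact: wE we].
    by split=> //; case: ifP.
  - exact: lik.
  - split; first by left.
    by exists (source e); rewrite -(hom_source h) hf /= k0.
have [[k1 we]|nlast] := pselect (k.+1 = m /\ wrong_end h' below c).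
  exists (fun S => S (target e) = on); split.
    by left; exists (target e) => //; rewrite pE; right.
  move=> S s; rewrite pE => /oE oS St ns.
  have Ss : S (source e) = below by case: oS => [//|]; rewrite St.
  exists (inl (target f)), (fun a => a.2 = s); split; last first.
  - move=> w Aw; apply: poisedP.
    rewrite !sE !tE k1 eqxx Ss St /= Aw.
    case: s ns {Aw} => // _; [left|right].
      by split=> //; case: ifP.
    by split=> //; [case: ifP|exact: wE we].
  - exact: lik.
  - split; first by right.
    exists (target e); rewrite -(hom_target h) hf /= -/(cut_vertex m e k.+1) k1.
    exact: cut_vertex_target.
exists (straddles ^~ e); split; first by right; exists e.
move=> S s; rewrite pE => /oE oS [Ss St] ns.
exists (inr e), (fun a => a.1 = if s is above then 1%N else (2 * m).-1); split.
- exact: pE.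
- by case: s ns.
move=> w Aw; apply: poisedP; rewrite !sE !tE Ss St Aw /=.
case: s ns {Aw} => // _.
- case: (eqVneq k.+1 m) => [k1|k1]; [right|left].
    split=> //; last by move=> we; apply: nlast.
    by case: ifP => // _; exact: threshold_last.
  split; last by apply: threshold_last; rewrite ltn_neqAle k1.
  by case: ifP => // _; exact: threshold_last.
- case: (eqVneq (k : nat) 0%N) => [k0|k0]; [right|left].
    split=> //; last by move=> we; apply: nfirst.
    by case: ifP => // _; exact: threshold_first.
  split; first by apply: threshold_first; rewrite lt0n.
  by case: ifP => // _; exact: threshold_first.
Qed.

End Poised.

(** * Bounds for one step and for one star *)

Lemma ind_and (R : realType) (P Q : Prop) : ind R (P /\ Q) = ind R P * ind R Q.
Proof.
have [p|np] := pselect P; last by rewrite (ind_false _ np) mul0r ind_false // => -[].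
rewrite (ind_true _ p) mul1r; apply: ind_iff; split => [[]//|q //].
Qed.

Lemma mass_bind_ge (R : realType) (A B : Type) (mu : seq (R * A))
    (k : A -> seq (R * B)) (P Ev : A -> Prop) (Q : B -> Prop) (kappa : R) :
  weighted mu -> (forall a, weighted (k a)) -> supported P mu ->
  (forall a, P a -> Ev a -> kappa <= mass (k a) Q) ->
  kappa * mass mu Ev <= mass (bind mu k) Q.
Proof.
move=> w wk sP PQ; rewrite /mass mean_bind -meanZ.
apply: (le_mean w sP) => a Pa.
have [e|ne] := pselect (Ev a); first by rewrite (ind_true _ e) mulr1; exact: PQ.
by rewrite (ind_false _ ne) mulr0; exact: mass_ge0.
Qed.

Lemma mass_bind_le (R : realType) (A B : Type) (mu : seq (R * A))
    (k : A -> seq (R * B)) (Ev : A -> Prop) (Q : B -> Prop) :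
  weighted mu -> (forall a, mass (k a) Q <= ind R (Ev a)) ->
  mass (bind mu k) Q <= mass mu Ev.
Proof.
move=> w kQ; rewrite /mass mean_bind.
by apply: (le_mean w (supportedT mu)) => a _; exact: kQ.
Qed.

(** Draws that matter are given distinct colours, all the others a common one, so
that finitely many draws suffice. *)
Lemma separating_colouring (A : Type) (L : seq {classic A}) :
  exists (n : nat) (col : A -> nat), (forall a, (col a < n)%N) /\
    forall a b : {classic A}, a \in L -> col a = col b -> a = b.
Proof.
exists (size L).+1, (fun a => index (a : {classic A}) L).
split=> [a|a b aL ab]; first by rewrite ltnS index_size.
have bL : b \in L by rewrite -index_mem -ab index_mem.
by rewrite -(nth_index a aL) ab nth_index.
Qed.

Section StepBounds.
Context (R : realType) (m : nat) (Y X : digraph).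
Context (h : digraph_hom Y (subdivision m X)).
Hypothesis m_ge2 : (2 <= m)%N.
Context (col : vertex Y + edge X -> nat) (n : nat).
Hypothesis col_lt : forall key, (col key < n)%N.

Let choice_w : weighted (choice_law R m). Proof. exact: choice_weighted. Qed.
Let choice_t : mean (choice_law R m) (fun=> 1) = 1. Proof. exact: choice_total. Qed.
Let stepS := step R h col n.

Lemma mass_step_likely S Q key A : likely R m A ->
  (forall w, A (w (col key)) -> Q (refine h col S w)) ->
  (2 * m%:R)^-1 <= mass (stepS S) Q.
Proof.
move=> lA AQ; apply: le_trans lA _.
have <- : mass (colourings R m n) (fun w => A (w (col key))) = mass (choice_law R m) A.
  exact: (mean_iid _ choice_t (fun c => ind R (A c)) (col_lt key)).
rewrite mass_step; apply: le_mass => //; exact: iid_weighted.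
Qed.

Lemma mass_step_likely2 S Q key key' A A' : col key <> col key' ->
  likely R m A -> likely R m A' ->
  (forall w, A (w (col key)) -> A' (w (col key')) -> Q (refine h col S w)) ->
  (2 * m%:R)^-1 * (2 * m%:R)^-1 <= mass (stepS S) Q.
Proof.
move=> kk lA lA' AQ.
have m0 : 0 <= (2 * m%:R)^-1 :> R by rewrite invr_ge0 mulr_ge0.
apply: le_trans (ler_pM m0 m0 lA lA') _.
have <- : mass (colourings R m n) (fun w => A (w (col key)) /\ A' (w (col key'))) =
    mass (choice_law R m) A * mass (choice_law R m) A'.
  rewrite -(mean_iid2 (0%N, on) choice_t (fun c => ind R (A c)) (fun c => ind R (A' c))
    (col_lt key) (col_lt key') kk).
  by congr mean; apply/funext => w; rewrite ind_and.
rewrite mass_step; apply: le_mass => [|w []]; [exact: iid_weighted|exact: AQ].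
Qed.

Lemma mass_step_never S Q P : (P \/ forall w, ~ Q (refine h col S w)) ->
  mass (stepS S) Q <= ind R P.
Proof.
case=> [p|nQ]; last by rewrite mass_step_false // ind_ge0.
rewrite (ind_true _ p) -(@mass_step_true R m Y X h m_ge2 col n S (fun=> True)) //.
by apply: le_mass => //; exact: weighted_step.
Qed.

Lemma mass_step_sure S Q : (forall w, Q (refine h col S w)) -> 1 <= mass (stepS S) Q.
Proof. by move=> QT; rewrite mass_step_true. Qed.

End StepBounds.

(** The good part must contain not only the cell of a point but also all edges at
a vertex cell, since a closed star may reach this vertex through any of them. *)
Definition tame (X : digraph) (GV : vertex X -> Prop) (GE : edge X -> Prop)
    (c : cell X) : Prop :=
  match c with
  | inl u => GV u /\ forall e, touches (inr e) u -> GE e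
  | inr e => GE e
  end.

Lemma tame_refine (m : nat) (Y X : digraph) (h : digraph_hom Y (subdivision m X))
    (GV : vertex X -> Prop) (GE : edge X -> Prop) (c : cell Y) : (2 <= m)%N ->
  tame GV GE (parent h c) ->
  tame (fun y => match hom_vertex h y with inl v => GV v | inr (e, _) => GE e end)
    (fun f => GE (hom_edge h f).1) c.
Proof.
move=> m_ge2; case: c => [y|f] //=.
case hy: (hom_vertex h y) => [v|[e i]] /=.
  case=> gv ge; split=> // f fy; apply: ge; case hf: (hom_edge h f) => [e k] /=.
  have [hs ht] := hom_edge_end m_ge2 v hf.
  by case: fy hy => <-; [move/hs => [_ ->]; left | move/ht => [_ ->]; right].
move=> ge; split=> // f fy; case hf: (hom_edge h f) => [e' k] /=.
have km := ltn_ord k; suff -> : e' = e by [].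
case: fy hy => <-; rewrite -?(hom_source h) -?(hom_target h) hf => /(cut_vertex_inr m_ge2).
  by case=> //; exact: ltnW.
by case.
Qed.

Definition same_side (X : digraph) (S : vertex X -> side) (c c' : cell X) : Prop :=
  exists s, [/\ s <> on, constant s S c & constant s S c'].

Definition split_side (X : digraph) (S : vertex X -> side) (c c' : cell X) : Prop :=
  exists s, [/\ s <> on, constant s S c & constant (opposite s) S c'].

Section StarBound.
Context (R : realType) (m : nat) (X : digraph).
Hypothesis m_ge2 : (2 <= m)%N.
Context (M : R) (GV : vertex X -> Prop) (GE : edge X -> Prop).
Context (mu : seq (R * (vertex X -> side))).
Hypothesis M_ge0 : 0 <= M.
Hypothesis GE_closed : forall e, GE e -> GV (source e) /\ GV (target e).
Hypothesis mu_slicing : slicing m M GV GE mu.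

Let m_gt0 : 0 < m%:R :> R. Proof. by rewrite ltr0n; lia. Qed.

(** Within a closed star the point and the centre are joined by one closed edge;
if they are not decided on the same side, the slice meets this edge, which has
mass [2 * M / m + M * (m - 1) / m]. *)
Lemma star_bound v c : tame GV GE c -> in_star v c ->
  mass mu (fun S => ~ (S v <> on /\ constant (S v) S c)) <= 2 * M.
Proof.
have [wmu omu von eba] := mu_slicing => gc sc.
have Mm : M / m%:R <= M.
  by rewrite ler_pdivrMr // ler_peMr // ler1n; lia.
case: sc => [cv|[e ev ce]].
  subst c; case: gc => gv _.
  apply: (@le_trans _ _ (mass mu (fun S => S v = on))); last first.
    by rewrite von //; apply: le_trans Mm _; move: M_ge0; lra.
  apply: le_mass => // S nS; apply: contrapT => ne; apply: nS; split=> //.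
  exact/constant_vertex.
have ge : GE e.
  by case: ce gc => -> //= [_]; apply; [left|right].
have [gs gt] := GE_closed ge.
apply: (@le_trans _ _ (mass mu (fun S => (S (source e) = on \/ S (target e) = on) \/
    (S (source e) = below /\ S (target e) = above)))).
  apply: (le_mass_on wmu omu) => S oS nS.
  have := oS e ge; rewrite /ordered.
  case Ss: (S (source e)); case St: (S (target e));
    do ?[by case]; try by [left; left|left; right|right].
  - move=> _; exfalso; apply: nS.
    have Sv : S v = below by case: ev => <-.
    rewrite Sv; split=> // u cu; move: cu; case: ce => -> /=; first by case=> <-.
      by move=> <-.
    by move=> <-.
  - move=> _; exfalso; apply: nS.
    have Sv : S v = above by case: ev => <-.
    rewrite Sv; split=> // u cu; move: cu; case: ce => -> /=; first by case=> <-.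
      by move=> <-.
    by move=> <-.
apply: le_trans (le_massU _ _ wmu) _; rewrite eba //.
have := le_massU (fun S => S (source e) = on) (fun S => S (target e) = on) wmu.
rewrite !von //.
have -> : M * m.-1%:R / m%:R = M - M / m%:R.
  by rewrite -subn1 natrB; [field; rewrite gt_eqF|lia].
by move: (M / m%:R) Mm M_ge0 => q; lra.
Qed.

Lemma star_pair_bound v c c' : tame GV GE c -> tame GV GE c' ->
  in_star v c -> in_star v c' ->
  mass mu (fun S => ~ same_side S c c') <= 4 * M.
Proof.
have [wmu _ _ _] := mu_slicing => gc gc' sc sc'.
have b := star_bound gc sc; have b' := star_bound gc' sc'.
apply: (@le_trans _ _ (2 * M + 2 * M)); last by lra.
apply: le_trans (lerD b b'); apply: le_trans (le_massU _ _ wmu).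
apply: le_mass => // S nS; apply: contrapT => /not_orP[/contrapT [n1 c1] /contrapT [_ c2]].
by apply: nS; exists (S v).
Qed.

Lemma event_bound Ev c :
  (exists2 v, touches c v & Ev = (fun S : vertex X -> side => S v = on)) \/
  (exists2 e, c = inr e & Ev = (@straddles X) ^~ e) ->
  tame GV GE c -> M / m%:R <= mass mu Ev.
Proof.
have [_ _ von eba] := mu_slicing.
case=> [[v cv ->]|[e -> ->]] gc.
  rewrite von //; case: c cv gc => [u /= <- []//|e /= ev ge].
  by have [gs gt] := GE_closed ge; case: ev => <-.
rewrite eba //; apply: ler_wpM2r; first by rewrite invr_ge0 ltW.
by rewrite ler_peMr // ler1n; lia.
Qed.

End StarBound.

(** * Induction over the levels *)

Lemma oppositeK : involutive opposite.
Proof. by case. Qed.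

Section Tower.
Context (R : realType) (m : nat).
Hypothesis m_ge2 : (2 <= m)%N.
Context (X : int -> digraph).
Context (h : forall i : int, digraph_hom (X (i + 1)) (subdivision m (X i))).
Context (T : eqType) (c : forall i : int, T -> cell (X i)).
Hypothesis parent_c : forall i x, parent (h i) (c (i + 1) x) = c i x.
Context (F : seq T) (k0 : int).

Definition scale (i : int) : R := m%:R ^ (- i).

Definition half_rate : R := (2 * m%:R)^-1 * (2 * m%:R)^-1 / m%:R.
Definition split_rate : R := (2 * m%:R)^-1 * half_rate.

Let m_gt0 : 0 < m%:R :> R. Proof. by rewrite ltr0n; lia. Qed.

Lemma scale_gt0 i : 0 < scale i. Proof. exact: exprz_gt0. Qed.

Lemma scaleS i : scale (i + 1) = scale i / m%:R.
Proof. by rewrite /scale opprD expfzDr ?gt_eqF. Qed.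

(** Halfway to separation: [y] has settled, and [x] can still be brought to the
other side by one draw. *)
Definition half_split (j : int) (S : vertex (X j) -> side) (x y : T) : Prop :=
  exists s, [/\ s <> on, constant s S (c j y) &
    poised (h j) (opposite s) S (c (j + 1) x)].

(** The induction hypothesis at level [j]: the masses of [slicing], together with
the bounds already acquired at the levels from [k0] to [j].  Both kinds of bounds
persist because settled cells stay settled.  The lower bound for a pair that is
apart at level [i] is acquired in two steps, of which the first is recorded by
[half_split]. *)
Definition good_law (j : int) (GV : vertex (X j) -> Prop) (GE : edge (X j) -> Prop)
    (mu : seq (R * (vertex (X j) -> side))) : Prop :=
  [/\ forall e, GE e -> GV (source e) /\ GV (target e),
      slicing m (scale j) GV GE mu,
      forall x, x \in F -> tame GV GE (c j x),
      forall x y i v, x \in F -> y \in F -> k0 <= i <= j ->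
        in_star v (c i x) -> in_star v (c i y) ->
        mass mu (fun S => ~ same_side S (c j x) (c j y)) <= 4 * scale i &
      forall x y i, x \in F -> y \in F -> k0 <= i -> ~ near (c i x) (c i y) ->
        (j = i + 1 ->
           half_rate * scale i <= mass mu (fun S => half_split S x y)) /\
        (i + 2 <= j ->
           split_rate * scale i <= mass mu (fun S => split_side S (c j x) (c j y)))].

Definition has_good_law (j : int) : Prop := exists GV GE mu, @good_law j GV GE mu.

Definition keys (j : int) (x : T) : seq {classic (vertex (X (j + 1)) + edge (X j))} :=
  match c (j + 1) x with
  | inl y => [:: inl y]
  | inr f => [:: inl (source f); inl (target f)]
  end ++ match c j x with inl _ => [::] | inr e => [:: inr e] end.

Lemma mem_keys j x key : is_key (h j) (c (j + 1) x) key ->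
  (key : {classic _}) \in keys j x.
Proof.
rewrite /keys mem_cat; case: key => [y|e] /=; last first.
  by rewrite parent_c => ->; rewrite inE eqxx orbT.
case=> + _; case: (c (j + 1) x) => [u|f] /=; first by move=> ->; rewrite inE eqxx.
by case=> ->; rewrite !inE eqxx ?orbT.
Qed.

(** New lower bounds come from independence.  If the cells of [x] and [y] share no
vertex at level [j], the draw that settles [y] and the one that starts steering
[x] to the opposite side are different. *)
Lemma good_law_step j : k0 <= j -> has_good_law j -> has_good_law (j + 1).
Proof.
move=> kj [GV [GE [mu [closed sl tm up low]]]].
have [wmu omu _ _] := sl.
have [n [col [col_lt col_inj]]] := separating_colouring (flatten [seq keys j x | x <- F]).
have colK x key key' : x \in F -> is_key (h j) (c (j + 1) x) key ->
    col key = col key' -> key = key'.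
  move=> xF ik; apply: col_inj; apply/flattenP; exists (keys j x).
    by apply/mapP; exists x.
  exact: mem_keys.
have oc S x : x \in F -> (forall e, GE e -> ordered S e) -> ordered_on S (c j x).
  by move=> xF oS e ce; apply: oS; have := tm x xF; rewrite ce.
pose stepS := step R (h j) col n.
have wstep S : weighted (stepS S) by exact: weighted_step.
pose GV' y := match hom_vertex (h j) y with inl v => GV v | inr (e, _) => GE e end.
pose GE' f := GE (hom_edge (h j) f).1.
have sl' : slicing m (scale (j + 1)) GV' GE' (bind mu stepS).
  by rewrite scaleS; apply: slicing_step.
have closed' f : GE' f -> GV' (source f) /\ GV' (target f).
  move=> gf; have : tame GV' GE' (inr f) by [].
  rewrite /GE' /GV' -(hom_source (h j)) -(hom_target (h j)) in gf *.
  case: (hom_edge (h j) f) gf => e k /= ge _.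
  have [gs gt] := closed e ge.
  have gC i : (i <= m)%N ->
      match cut_vertex m e i with inl v => GV v | inr (e', _) => GE e' end.
    move=> im; case ci: (cut_vertex m e i) => [v|[e' i']].
      by have [[_ ->]|[_ ->]] := cut_vertex_inl m_ge2 im ci.
    by have [-> _] := cut_vertex_inr m_ge2 im ci.
  by split; [apply: gC; exact: ltnW | exact: (gC k.+1)].
have tm' x : x \in F -> tame GV' GE' (c (j + 1) x).
  by move=> xF; apply: tame_refine => //; rewrite parent_c; exact: tm.
exists GV', GE', (bind mu stepS); split=> //.
- move=> x y i v xF yF /andP[ki ij] sx sy.
  have [ij1|ne] := eqVneq i (j + 1).
    subst i; exact: (star_pair_bound m_ge2 (ltW (scale_gt0 _)) closed' sl'
      (tm' x xF) (tm' y yF) sx sy).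
  have {ne}ij : i <= j by lia.
  apply: le_trans (up x y i v xF yF _ sx sy); last by rewrite ki.
  apply: mass_bind_le => // S.
  apply: mass_step_never => //.
  have [[s [ns cx cy]]|nsame] := pselect (same_side S (c j x) (c j y)); last by left.
  right=> w nS; apply: nS; exists s; split=> //.
    by apply: constant_refine => //; rewrite parent_c.
  by apply: constant_refine => //; rewrite parent_c.
- move=> x y i xF yF ki nxy; split.
    move=> /addIr ji; subst i.
    have pcc : parent (h j) (parent (h (j + 1)) (c (j + 1 + 1) x)) = c j x.
      by rewrite !parent_c.
    (* [j] is the first level of the pair: settle [y] and start steering [x]. *)
    have [Ev [evE evP]] := poised_after_event R m_ge2 (h j) (h (j + 1)) col (c (j + 1 + 1) x).
    rewrite pcc parent_c in evE evP.
    have evb := event_bound m_ge2 (ltW (scale_gt0 j)) closed sl evE (tm x xF).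
    have r0 : 0 <= (2 * m%:R)^-1 * (2 * m%:R)^-1 :> R by rewrite mulr_ge0 // invr_ge0 mulr_ge0.
    rewrite /half_rate mulrAC -mulrA.
    apply: le_trans (ler_wpM2l r0 evb) _.
    apply: (mass_bind_ge wmu wstep omu) => S oS evS.
    have osy : ordered_on S (parent (h j) (c (j + 1) y)).
      by rewrite parent_c; exact: oc.
    have [ky [A [s [iky lA ns Ay]]]] := settle R m_ge2 col osy.
    have nos : opposite s <> on by case: s ns {Ay}.
    have [kx [B [ikx lB Bx]]] := evP S (opposite s) (oc S x xF oS) evS nos.
    have kk : col ky <> col kx.
      move=> /(colK y _ _ yF iky) kE; subst ky.
      apply: nxy; rewrite -(parent_c j x) -(parent_c j y).
      exact: (key_near m_ge2 ikx iky).
    apply: (mass_step_likely2 m_ge2 col_lt kk lA lB) => w Aw Bw.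
    by exists s; split=> //; [exact: Ay|exact: Bx].
  (* One level later, a single draw completes the separation. *)
  move=> ij; have [ij1|ij1] := eqVneq j (i + 1).
    have [lo _] := low x y i xF yF ki nxy; have {lo} := lo ij1.
    have r0 : 0 <= (2 * m%:R)^-1 :> R by rewrite invr_ge0 mulr_ge0.
    move=> lo; rewrite /split_rate -mulrA; apply: le_trans (ler_wpM2l r0 lo) _.
    apply: (mass_bind_ge wmu wstep omu) => S oS [s [ns cy px]].
    have nos : opposite s <> on by case: s ns {cy px}.
    have [key [A [lA Ax]]] := poised_settle R m_ge2 col nos px.
    apply: (mass_step_likely m_ge2 col_lt (key := key) lA) => w Aw.
    exists (opposite s); split=> //; first exact: Ax.
    rewrite oppositeK.
    by apply: constant_refine => //; rewrite parent_c.
  have [_ lo] := low x y i xF yF ki nxy.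
  apply: le_trans (lo _) _; first by lia.
  rewrite -[X in X <= _]mul1r.
  apply: (mass_bind_ge wmu wstep omu) => S oS [s [ns cx cy]].
  apply: mass_step_sure => // w.
  have nos : opposite s <> on by case: s ns {cx cy}.
  exists s; split=> //.
    by apply: constant_refine => //; rewrite parent_c.
  by apply: constant_refine => //; rewrite parent_c.
Qed.

Lemma good_law_above j : has_good_law k0 -> k0 <= j -> has_good_law j.
Proof.
move=> P0 kj; have [n ->] : exists n : nat, j = k0 + n%:Z.
  by exists `|j - k0|%N; lia.
elim: n {kj} => [|n IH]; first by rewrite addr0.
have -> : k0 + n.+1%:Z = k0 + n%:Z + 1 by lia.
by apply: good_law_step => //; lia.
Qed.

End Tower.

(** * The initial law on a star *)

Section Acyclic.
Context (m : nat) (Y X : digraph) (h : digraph_hom Y (subdivision m X)).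
Hypothesis m_ge2 : (2 <= m)%N.

Definition loopless (G : digraph) : Prop := forall e : edge G, source e <> target e.

Definition antisymmetric_edges (G : digraph) : Prop :=
  forall e f : edge G, source e = target f -> target e <> source f.

(** A subdivision into at least two pieces has no loop, and a morphism maps loops
to loops. *)
Lemma hom_loopless : loopless Y.
Proof.
move=> f; move/(congr1 (hom_vertex h)); rewrite -(hom_source h) -(hom_target h).
case: (hom_edge h f) => e k; rewrite [source _]/= [target _]/= -/(cut_vertex m e k.+1).
have km := ltn_ord k; have [k0|k0] := posnP k.
  rewrite k0; have [|i _ ->//] := @cut_vertex_inner m X m_ge2 e 1; lia.
have [|i ik ->] := @cut_vertex_inner m X m_ge2 e k; first by rewrite k0.
by move/esym/(cut_vertex_inr m_ge2 km) => [_]; lia.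
Qed.

(** Two opposite edges would map to two consecutive pieces that close up, which is
possible only for the two halves of a loop. *)
Lemma hom_antisymmetric : loopless X -> antisymmetric_edges Y.
Proof.
move=> noloop f g fg gf.
have := congr1 (hom_vertex h) fg; have := congr1 (hom_vertex h) gf.
rewrite -!(hom_source h) -!(hom_target h) {fg gf}.
case: (hom_edge h f) => e k; case: (hom_edge h g) => e' k'.
rewrite ![source _]/= ![target _]/= -/(cut_vertex m e k.+1) -/(cut_vertex m e' k'.+1).
have km := ltn_ord k; have km' := ltn_ord k'.
(* If one of the two pieces starts at an inner vertex, both belong to the same
   edge, which closes up and is a loop. *)
have wrap (a b : edge X) (p q : nat) : (0 < p < m)%N -> (q < m)%N ->
    cut_vertex m a p = cut_vertex m b q.+1 -> cut_vertex m a p.+1 = cut_vertex m b q ->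
    False.
  move=> /andP[p0 pm] qm; have [|i ip ->] := @cut_vertex_inner m X m_ge2 a p; first by rewrite p0.
  move=> /esym/(cut_vertex_inr m_ge2 qm) [ab qi]; subst b.
  have {qi} qp : q.+1 = p by lia.
  have [q0|q0] := posnP q; last first.
    have [|j jq ->] := @cut_vertex_inner m X m_ge2 a q; first by rewrite q0.
    by move=> /(cut_vertex_inr m_ge2 pm) [_]; lia.
  rewrite q0 /= => /(cut_vertex_inl m_ge2 pm) [[//]|[_ st]].
  exact: (noloop a).
move=> tf sf; have [k0|k0] := posnP k; last by apply: (wrap e e' k k'); rewrite ?k0.
have [k0'|k0'] := posnP k'; last by apply: (wrap e' e k' k) => //; rewrite ?k0'.
move: tf; rewrite k0 k0'.
have [|i _ ->//] := @cut_vertex_inner m X m_ge2 e 1; lia.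
Qed.

End Acyclic.

Section StarLaw.
Context (R : realType) (m : nat) (X : digraph) (v0 : vertex X) (M : R).
Hypothesis m_ge2 : (2 <= m)%N.
Hypothesis M_ge0 : 0 <= M.
Hypothesis X_loopless : loopless X.
Hypothesis X_antisymmetric : antisymmetric_edges X.

(** Sources of edges into [v0] have height 0, the centre 1, all others 2.  Loops or
pairs of opposite edges at [v0] would make this ambiguous. *)
Definition height (u : vertex X) : nat :=
  if `[< u = v0 >] then 1%N
  else if `[< exists2 e, source e = u & target e = v0 >] then 0%N else 2.

(** The cuts of a star by height: through one of the three heights (even values)
or between two of them (odd values). *)
Definition star_law : seq (R * (vertex X -> side)) :=
  [seq (M * p.1 / m%:R, fun u => threshold p.2 (height u)) |
    p <- [:: (1, 0%N); (m.-1%:R, 1%N); (1, 2%N); (m.-1%:R, 3%N); (1, 4%N)]].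

Lemma height_lt3 u : (height u < 3)%N.
Proof. by rewrite /height; do 2?[case: asboolP => _]. Qed.

Lemma height_center : height v0 = 1%N.
Proof. by rewrite /height; case: asboolP. Qed.

Lemma height_source e : target e = v0 -> height (source e) = 0%N.
Proof.
move=> te; rewrite /height; case: asboolP => [se|_].
  by have := @X_loopless e; rewrite se te.
by case: asboolP => // -[]; exists e.
Qed.

Lemma height_target e : source e = v0 -> height (target e) = 2.
Proof.
move=> se; rewrite /height; case: asboolP => [te|_].
  by have := @X_loopless e; rewrite se te.
case: asboolP => // -[f fs ft].
by have := X_antisymmetric (etrans se (esym ft)) (esym fs).
Qed.

Lemma height_edge e : touches (inr e) v0 ->
  (height (source e) = 0%N /\ height (target e) = 1%N) \/
  (height (source e) = 1%N /\ height (target e) = 2%N).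
Proof.
case=> ev; [right|left].
  by rewrite height_target // ev height_center.
by rewrite height_source // ev height_center.
Qed.

Definition star_vertex (v : vertex X) : Prop :=
  v = v0 \/ exists2 e, touches (inr e) v0 & touches (inr e) v.

Lemma star_slicing :
  slicing m M star_vertex (fun e => touches (inr e) v0) star_law.
Proof.
have m0 : 0 <= m%:R :> R by [].
split.
- by rewrite /weighted /star_law /= !divr_ge0 ?mulr_ge0.
- rewrite /supported all_map; apply/allP => -[a t] tin; apply/asboolP => e /height_edge.
  rewrite /ordered /=.
  case=> -[-> ->]; move: tin; rewrite !inE;
    by do 4?[case/orP] => /eqP[_ ->]; rewrite /threshold /=; by [left|right].
- move=> v _; rewrite /mass /mean /star_law !big_cons big_nil /=.
  have := height_lt3 v.
  rewrite !ind_side; case: (height v) => [|[|[|//]]] _ /=;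
  by rewrite ?mulr1 ?mulr0 ?addr0 ?add0r.
- move=> e /height_edge he; rewrite /mass /mean /star_law !big_cons big_nil /=.
  rewrite !ind_and !ind_side.
  by case: he => -[-> ->] /=; rewrite ?mulr1 ?mulr0 ?mul0r ?mul1r ?mulr1 ?mulr0 ?addr0 ?add0r.
Qed.

Lemma star_law_closed e : touches (inr e) v0 ->
  star_vertex (source e) /\ star_vertex (target e).
Proof. by move=> ev; split; right; exists e => //; [left|right]. Qed.

Lemma star_tame c : touches c v0 -> tame star_vertex (fun e => touches (inr e) v0) c.
Proof. by case: c => [u|e] //= ->; split=> //; left. Qed.

End StarLaw.

(** * Descending to coarser levels *)

Section Descent.
Context (m : nat) (Y X : digraph) (h : digraph_hom Y (subdivision m X)).
Hypothesis m_ge2 : (2 <= m)%N.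
Implicit Types (c : cell Y).

Lemma near_refl (G : digraph) (c : cell G) : near c c.
Proof.
case: c => [u|e]; first by exists u.
by exists (source e); split; left.
Qed.

Lemma near_sym (G : digraph) (c c' : cell G) : near c c' -> near c' c.
Proof. by case=> v [cv c'v]; exists v. Qed.

(** An edge, or a vertex with its edges, maps into the open star of one vertex: of
any two consecutive vertices of a subdivision at most one is an old vertex. *)
Lemma neighbourhood_collapses c : exists v, forall c', near c c' ->
  touches (parent h c') v.
Proof.
case: c => [y|f].
  case hy: (hom_vertex h y) => [v|[e i]].
    exists v => c' [u [<-]] cu; exact: (touches_parent m_ge2 cu hy).
  exists (source e) => c' [u [<-]] cu; rewrite (parent_inner m_ge2 cu hy).
  by left.
case hf: (hom_edge h f) => [e k]; have km := ltn_ord k.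
have hs : hom_vertex h (source f) = cut_vertex m e k by rewrite -(hom_source h) hf.
have ht : hom_vertex h (target f) = cut_vertex m e k.+1 by rewrite -(hom_target h) hf.
have inner y c' p : touches c' y -> hom_vertex h y = cut_vertex m e p ->
    (0 < p < m)%N -> parent h c' = inr e.
  move=> cy hy pin; have [i _ ci] := cut_vertex_inner m_ge2 e pin.
  by apply: (parent_inner m_ge2 cy); rewrite hy ci.
have [k0|k0] := posnP k.
  exists (source e) => c' [u [[]<- cu]].
    by apply: (touches_parent m_ge2 cu); rewrite hs k0.
  by rewrite (inner _ _ _ cu ht); [left|lia].
exists (target e) => c' [u [[]<- cu]].
  by rewrite (inner _ _ _ cu hs); [right|lia].
have [k1|k1] := eqVneq k.+1 m.
  by apply: (touches_parent m_ge2 cu); rewrite ht k1 cut_vertex_target.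
by rewrite (inner _ _ _ cu ht); [right|lia].
Qed.

Lemma near_parent c c' : near c c' -> near (parent h c) (parent h c').
Proof.
move=> cc'; have [v vP] := neighbourhood_collapses c.
by exists v; split; apply: vP => //; exact: near_refl.
Qed.

End Descent.

Section Threads.
Context (m : nat).
Hypothesis m_ge2 : (2 <= m)%N.
Context (X : int -> digraph).
Context (h : forall i : int, digraph_hom (X (i + 1)) (subdivision m (X i))).

(** Transport along an equation between levels, needed since [i - 1 + 1] and [i] are
not convertible. *)
Definition recast (i j : int) (ij : i = j + 1) (c : cell (X i)) : cell (X (j + 1)) :=
  ecast k (cell (X k)) ij c.

Definition down (i : int) (c : cell (X i)) : cell (X (i - 1)) :=
  parent (h (i - 1)) (recast (esym (subrK 1 i)) c).

Fixpoint near_below (d : nat) (i : int) (c c' : cell (X i)) : Prop :=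
  if d is d'.+1 then near_below d' (down c) (down c') else near c c'.

Lemma recast_id i (E : i + 1 = i + 1) (c : cell (X (i + 1))) : recast E c = c.
Proof. by rewrite /recast (eq_irrelevance E (erefl _)). Qed.

Lemma near_down i (c c' : cell (X i)) : near c c' -> near (down c) (down c').
Proof.
rewrite /down; move: (esym _); move: (i - 1) => j E; subst i.
by rewrite !recast_id; exact: near_parent.
Qed.

Lemma down_collapses i (c : cell (X i)) :
  exists v, forall c', near c c' -> touches (down c') v.
Proof.
rewrite /down; move: (esym _); move: (i - 1) => j E; subst i.
have [v vP] := neighbourhood_collapses (h j) m_ge2 c.
by exists v => c' cc'; rewrite recast_id; exact: vP.
Qed.

Lemma near_belowS d i (c c' : cell (X i)) : near_below d c c' -> near_below d.+1 c c'.
Proof.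
elim: d i c c' => [|d IH] i c c' /=; first exact: near_down.
exact: IH.
Qed.

Lemma near_below_le d d' i (c c' : cell (X i)) : (d <= d')%N ->
  near_below d c c' -> near_below d' c c'.
Proof.
move=> /subnK <-; elim: (d' - d)%N => // n IH /IH; exact: near_belowS.
Qed.

(** By [neighbourhood_collapses] two cells near a third one become near each other
one level below; iterating, whole components collapse. *)
Lemma near_below_trans d i (a b c : cell (X i)) :
  near_below d a b -> near_below d b c -> near_below d.+1 a c.
Proof.
elim: d i a b c => [|d IH] i a b c /=; last exact: IH.
move=> ab bc; have [v vP] := down_collapses b.
by exists v; split; apply: vP => //; exact: near_sym.
Qed.

Context (T : eqType) (c : forall i : int, T -> cell (X i)).
Hypothesis parent_c : forall i x, parent (h i) (c (i + 1) x) = c i x.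

Lemma down_thread i x : down (c i x) = c (i - 1) x.
Proof.
rewrite /down; move: (esym _); move: (i - 1) => j E; subst i.
by rewrite recast_id.
Qed.

Lemma near_below_thread d i x y : near_below d (c i x) (c i y) ->
  near (c (i - d%:Z) x) (c (i - d%:Z) y).
Proof.
elim: d i => [|d IH] i /=; first by rewrite subr0.
rewrite !down_thread => /IH; have -> : i - 1 - d%:Z = i - d.+1%:Z by lia.
by [].
Qed.

Lemma near_thread_le k j x y : j <= k -> near (c k x) (c k y) -> near (c j x) (c j y).
Proof.
move=> jk; have [n ->] : exists n : nat, k = j + n%:Z by exists `|k - j|%N; lia.
elim: n => [|n IH]; first by rewrite addr0.
have -> : j + n.+1%:Z = j + n%:Z + 1 by lia.
move=> nk; apply: IH; rewrite -(parent_c (j + n%:Z) x) -(parent_c (j + n%:Z) y).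
exact: near_parent.
Qed.

Hypothesis eventually_near : forall x y, exists k, near (c k x) (c k y).

(** All points of a finite set eventually become near [x0], and their cells then
collapse to cells around one vertex. *)
Lemma centred (F : seq T) (K : int) (x0 : T) :
  exists2 k, k <= K & exists v, forall x, x \in F -> touches (c k x) v.
Proof.
have [k kK nk] : exists2 k, k <= K & forall x, x \in F -> near (c (k + 1) x0) (c (k + 1) x).
  elim: F => [|x F [k kK IH]]; first by exists K.
  have [k' nk'] := eventually_near x0 x.
  exists (Num.min k (k' - 1)); first by lia.
  move=> y; rewrite inE => /orP[/eqP ->|/IH].
    by apply: near_thread_le nk'; lia.
  by apply: near_thread_le; lia.
have [v vP] := neighbourhood_collapses (h k) m_ge2 (c (k + 1) x0).
exists k => //; exists v => x /nk /vP; rewrite parent_c.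
by [].
Qed.

End Threads.

(** * Finitely many constraints *)

(** The final cut of the points.  For a cell that has not settled the choice of the
source is arbitrary. *)
Definition side_cut (X : digraph) (c : cell X) (S : vertex X -> side) : bool :=
  if S (match c with inl u => u | inr e => source e end) is above then true else false.

Lemma side_cut_constant (X : digraph) (c : cell X) S s : constant s S c ->
  side_cut c S = if s is above then true else false.
Proof.
move=> cst; rewrite /side_cut (cst (match c with inl u => u | inr e => source e end)) //.
by case: c {cst} => //= e; left.
Qed.

Section Approximation.
Context (R : realType) (m : nat).
Hypothesis m_ge2 : (2 <= m)%N.
Context (X : int -> digraph).
Context (h : forall i : int, digraph_hom (X (i + 1)) (subdivision m (X i))).
Context (T : choiceType) (c : forall i : int, T -> cell (X i)).
Hypothesis parent_c : forall i x, parent (h i) (c (i + 1) x) = c i x.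
Hypothesis eventually_near : forall x y, exists k, near (c k x) (c k y).

Let m_gt0 : 0 < m%:R :> R. Proof. by rewrite ltr0n; lia. Qed.

Lemma initial_good_law (F : seq T) (k : int) (v : vertex (X k)) :
  (forall x, x \in F -> touches (c k x) v) -> has_good_law R h c F k k.
Proof.
move=> Fv.
have loop0 i : loopless (X i).
  have -> : i = i - 1 + 1 by rewrite subrK.
  exact: (hom_loopless (h (i - 1)) m_ge2).
have anti0 i : antisymmetric_edges (X i).
  have -> : i = i - 1 + 1 by rewrite subrK.
  exact: (hom_antisymmetric (h (i - 1)) m_ge2 (@loop0 _)).
have s0 : 0 <= scale R m k := ltW (scale_gt0 R m_ge2 k).
have sl := star_slicing m v s0 (@loop0 k) (@anti0 k).
have tm x : x \in F -> tame (star_vertex v) (fun e => touches (inr e) v) (c k x).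
  by move=> /Fv; exact: star_tame.
exists (star_vertex v), (fun e => touches (inr e) v), (star_law m v (scale R m k)).
split=> //.
- exact: star_law_closed.
- move=> x y i u xF yF ik sx sy; have ik' : i = k by lia.
  subst i.
  exact: (star_pair_bound m_ge2 s0 (@star_law_closed _ v) sl (tm x xF) (tm y yF) sx sy).
- by move=> x y i _ _ ki _; split=> ?; lia.
Qed.

(** Points in a common closed star of level [i] are at distance at most
[2 * scale i], and if they are apart at the next level also at least a fixed
multiple of [scale (i + 1)]. *)
Definition cut_constraint : set (T * T * R * R) := [set q |
  exists i v, [/\ in_star v (c i q.1.1.1), in_star v (c i q.1.1.2),
    q.2 = 2 * scale R m i &
    q.1.2 = 0 \/ (~ near (c (i + 1) q.1.1.1) (c (i + 1) q.1.1.2) /\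
      q.1.2 = split_rate R m / 2 * scale R m (i + 1))]].

(** The weights are halved because [star_pair_bound] gives twice the bound that
is wanted. *)
Lemma finite_cuts (s : seq (T * T * R * R)) :
  (forall q, q \in s -> cut_constraint q) ->
  exists mu : seq (R * (T -> bool)), weighted mu /\
    forall x y a b, (x, y, a, b) \in s ->
      a <= mass mu (fun A => A x <> A y) <= b.
Proof.
case: s => [|q0 s0] sC; first by exists [::].
set s := q0 :: s0 in sC *.
pose F := [seq q.1.1.1 | q <- s] ++ [seq q.1.1.2 | q <- s].
(* A range of levels that contains all the scales that occur in [s], with two
   further levels for the separation. *)
have [lo [hi bnd]] : exists lo hi : int, forall q, q \in s -> exists i v,
    [/\ lo <= i, i + 3 <= hi, in_star v (c i q.1.1.1) /\ in_star v (c i q.1.1.2),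
    q.2 = 2 * scale R m i &
    q.1.2 = 0 \/ (~ near (c (i + 1) q.1.1.1) (c (i + 1) q.1.1.2) /\
      q.1.2 = split_rate R m / 2 * scale R m (i + 1))].
  elim: (s) sC => [|q s' IH] sC; first by exists 0, 0.
  have [lo [hi bnd]] := IH (fun q' q's => sC q' (@mem_behead _ (q :: s') _ q's)).
  have [i [v [vx vy qb qa]]] := sC q (mem_head _ _).
  exists (Num.min lo i), (Num.max hi (i + 3)) => q'.
  rewrite inE => /orP[/eqP ->|/bnd [i' [v' [li ih st qb' qa']]]].
    by exists i, v; split=> //; lia.
  by exists i', v'; split=> //; lia.
have [k klo [v Fv]] := centred m_ge2 parent_c eventually_near F (Num.min lo hi) q0.1.1.1.
have kh : k <= hi by lia.
have [GV [GE [mu [_ [wmu _ _ _] _ up low]]]] :=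
  good_law_above m_ge2 parent_c (initial_good_law Fv) kh.
pose cut (S : vertex (X hi) -> side) : T -> bool := fun x => side_cut (c hi x) S.
exists [seq (2^-1 * p.1, cut p.2) | p <- mu]; split.
  by rewrite /weighted all_map; apply: sub_all wmu => p /= p0; rewrite mulr_ge0 // invr_ge0.
move=> x y a b qs; have [i [u [li ih [sx sy] /= bE aE]]] := bnd _ qs.
have xF : x \in F by rewrite mem_cat; apply/orP; left; apply/mapP; exists (x, y, a, b).
have yF : y \in F by rewrite mem_cat; apply/orP; right; apply/mapP; exists (x, y, a, b).
have -> : mass [seq (2^-1 * p.1, cut p.2) | p <- mu] (fun A => A x <> A y) =
    2^-1 * mass mu (fun S => cut S x <> cut S y).
  rewrite /mass /mean big_map big_distrr /=.
  by apply: eq_bigr => p _; rewrite mulrA.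
have ub : mass mu (fun S => cut S x <> cut S y) <= 4 * scale R m i.
  apply: le_trans (up x y i u xF yF _ sx sy); last by lia.
  apply: le_mass => // S ne [t [nt cx cy]]; apply: ne.
  by rewrite /cut (side_cut_constant cx) (side_cut_constant cy).
apply/andP; split; last by rewrite bE; lra.
case: aE => [->|[nn ->]]; first by rewrite mulr_ge0 ?invr_ge0 ?mass_ge0.
have ki : k <= i + 1 by lia.
have [_ lb] := low x y (i + 1) xF yF ki nn.
rewrite mulrAC [leLHS]mulrC; apply: ler_wpM2l; first by rewrite invr_ge0.
apply: le_trans (lb _) _; first by lia.
apply: le_mass => // S [t [nt cx cy]].
rewrite /cut (side_cut_constant cx) (side_cut_constant cy).
by case: t nt {cx cy}.
Qed.

End Approximation.

(** * Realizations and the inverse limit *)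

Section RealizationCells.
Context (R : realType).

Definition cell_of (X : digraph) (p : realization R X) : cell X :=
  match p with Vertex v => inl v | Inner e _ => inr e end.

Lemma cell_edge_point (X : digraph) (e : edge X) (t : R) : 0 < t < 1 ->
  cell_of (edge_point e t) = inr e.
Proof. by move=> t01; rewrite /edge_point insubT. Qed.

Lemma cell_closed_edge (X : digraph) (e : edge X) (p : realization R X) :
  closed_edge e p ->
  [\/ cell_of p = inr e, cell_of p = inl (source e) | cell_of p = inl (target e)].
Proof.
case=> t _ <-; rewrite /edge_point; case: insubP => [u _ _|_] /=.
  by constructor 1.
by case: ifP => _; [constructor 2|constructor 3].
Qed.

Lemma closed_edge_near (X : digraph) (e : edge X) (p : realization R X) :
  closed_edge e p -> near (inr e) (cell_of p).
Proof.
move=> /cell_closed_edge [] ->; first exact: near_refl.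
  by exists (source e); split=> //; left.
by exists (target e); split=> //; right.
Qed.

Lemma closed_star_in_star (X : digraph) (v : vertex X) (p : realization R X) :
  closed_star v p -> in_star v (cell_of p).
Proof.
case=> [->|[e /= ev /cell_closed_edge ce]]; first by left.
by right; exists e.
Qed.

Lemma touches_closed_star (X : digraph) (v : vertex X) (p : realization R X) :
  touches (cell_of p) v -> closed_star v p.
Proof.
case: p => [u /= ->|e t /= ev]; first by left.
right; exists e => //; exists (val t); last by rewrite /edge_point valK.
by have /andP[t0 t1] := valP t; rewrite /= !ltW.
Qed.

Lemma cell_unsubdivide (m : nat) (Y X : digraph)
    (h : digraph_hom Y (subdivision m X)) (p : realization R Y) : (2 <= m)%N ->
  cell_of (unsubdivide (realize_hom h p)) = parent h (cell_of p).
Proof.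
move=> m_ge2; have m0 : 0 < m%:R :> R by rewrite ltr0n; lia.
case: p => [w|f t] /=.
  case: (hom_vertex h w) => [v//|[e i]]; apply: cell_edge_point.
  rewrite divr_gt0 //= ltr_pdivrMr // mul1r ltr_nat.
  by have := ltn_ord i; lia.
case: (hom_edge h f) => e k /=; apply: cell_edge_point.
have /andP[t0 t1] := valP t.
rewrite divr_gt0 ?ltr_wpDl //= ltr_pdivrMr // mul1r.
have : k.+1%:R <= m%:R :> R by rewrite ler_nat.
by rewrite -natr1; apply: lt_le_trans; rewrite ltrD2l.
Qed.

End RealizationCells.

Section Limit.
Context (R : realType) (m : nat) (X : int -> digraph).
Context (proj : forall i : int, realization R (X (i + 1)) -> realization R (X i)).
Hypothesis adm : admissible proj m.

Let m_ge2 : (2 <= m)%N := admissible_ge2 adm.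

Definition level_hom (i : int) : digraph_hom (X (i + 1)) (subdivision m (X i)) :=
  sval (cid (admissible_simplicial adm i)).

Definition limit_cell (i : int) (x : inverse_limit proj) : cell (X i) :=
  cell_of (limit_proj i x).

Lemma parent_level_hom (i : int) (p : realization R (X (i + 1))) :
  parent (level_hom i) (cell_of p) = cell_of (proj p).
Proof.
rewrite /level_hom; case: (cid _) => /= h hp.
by rewrite hp cell_unsubdivide.
Qed.

Lemma parent_limit_cell i x :
  parent (level_hom i) (limit_cell (i + 1) x) = limit_cell i x.
Proof. by rewrite parent_level_hom /limit_cell /limit_proj (svalP x). Qed.

Lemma projects_to_limit i (p : realization R (X i)) k (q : realization R (X k))
    (x : inverse_limit proj) :
  projects_to proj p q -> p = limit_proj i x -> q = limit_proj k x.
Proof.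
elim=> // {i p k q} i p k q _ IH px; apply: IH.
by rewrite px /limit_proj (svalP x).
Qed.

(** The points of the chain need not come from the limit, which is why
[near_below] speaks of arbitrary cells. *)
Lemma same_component_near i (p q : realization R (X i)) : same_component p q ->
  exists d, near_below level_hom d (cell_of p) (cell_of q).
Proof.
elim=> {p q} [p q [e [pe qe]]|p|p q r _ [d pq] _ [d' qr]].
- exists 1%N; apply: (near_below_trans m_ge2 (b := inr e) (d := 0)) => /=.
    by apply: near_sym; exact: closed_edge_near.
  exact: closed_edge_near.
- by exists 0%N; exact: near_refl.
- exists (maxn d d').+1; apply: (near_below_trans m_ge2 (b := cell_of q)).
    by apply: near_below_le pq => //; exact: leq_maxl.
  by apply: near_below_le qr => //; exact: leq_maxr.
Qed.

Lemma limit_eventually_near x y : exists k, near (limit_cell k x) (limit_cell k y).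
Proof.
have [k [p [q [_ xp yq pq]]]] :=
  admissible_connected adm (limit_proj 0 x) (limit_proj 0 y).
have pE := projects_to_limit xp erefl; have qE := projects_to_limit yq erefl.
have [d nd] := same_component_near pq; rewrite pE qE in nd.
by exists (k - d%:Z); exact: (near_below_thread m_ge2 (T := {classic (inverse_limit proj)})
  parent_limit_cell nd).
Qed.

Lemma near_common_star i x y : near (limit_cell i x) (limit_cell i y) ->
  exists v, closed_star v (limit_proj i x) /\ closed_star v (limit_proj i y).
Proof.
by move=> [v [xv yv]]; exists v; split; exact: touches_closed_star.
Qed.

Lemma dbar_le i x y : near (limit_cell i x) (limit_cell i y) ->
  dbar m x y <= 2 * scale R m i.
Proof.
move=> /near_common_star [v [xv yv]]; apply: sup_le_ub.
  exists 0, (fun _ _ => 0) => //; split.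
    by split=> // *; rewrite addr0.
  move=> j w a b _ _; rewrite mulr_ge0 //; exact: ltW (scale_gt0 R m_ge2 j).
by move=> _ [rho [_ bnd] <-]; exact: bnd xv yv.
Qed.

Lemma le_dbar (rho : inverse_limit proj -> inverse_limit proj -> R) x y :
  pseudo_distance rho -> star_bounded m rho -> rho x y <= dbar m x y.
Proof.
move=> prho brho; apply: ub_le_sup; last by exists rho.
have [k /near_common_star [v [xv yv]]] := limit_eventually_near x y.
by exists (2 * scale R m k) => _ [r [_ bnd] <-]; exact: bnd xv yv.
Qed.

(** Points that are near at all fine levels have distance zero; otherwise there is
a last level at which they are near, which determines their distance up to a
factor depending on [m]. *)
Lemma dbar_dichotomy x y :
  (forall e, 0 < e -> dbar m x y <= e) \/
  exists i, near (limit_cell i x) (limit_cell i y) /\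
    ~ near (limit_cell (i + 1) x) (limit_cell (i + 1) y).
Proof.
have [k nk] := limit_eventually_near x y.
have [[i [ni nn]]|nex] := pselect (exists i, near (limit_cell i x) (limit_cell i y) /\
    ~ near (limit_cell (i + 1) x) (limit_cell (i + 1) y)).
  by right; exists i.
left=> e e0.
have near_all (n : nat) : near (limit_cell (k + n%:Z) x) (limit_cell (k + n%:Z) y).
  elim: n => [|n IH]; first by rewrite addr0.
  have -> : k + n.+1%:Z = k + n%:Z + 1 by lia.
  by apply: contrapT => nn; apply: nex; exists (k + n%:Z).
have m0 : 0 < m%:R :> R by rewrite ltr0n; lia.
pose C : R := 2 * scale R m k.
have C0 : 0 < C by rewrite mulr_gt0 // scale_gt0.
have [n Cn] : exists n : nat, C / e <= n%:R.
  exists (Num.truncn (C / e)).+1; apply: ltW.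
  by have /andP[] := truncn_itv (ltW (divr_gt0 C0 e0)).
apply: le_trans (dbar_le (near_all n)) _.
rewrite /scale opprD expfzDr ?gt_eqF // mulrA -/(scale R m k) -/C.
rewrite -exprnN ler_pdivrMr ?exprn_gt0 //.
rewrite -ler_pdivrMl // mulrC; apply: le_trans Cn _.
by rewrite -natrX ler_nat; apply: ltnW; exact: ltn_expl.
Qed.

End Limit.

Theorem theorem1p16 (R : realType) (m : nat) (hm : (2 <= m)%N) :
  exists L : R, 1 <= L /\
    forall (X : int -> digraph)
      (proj : forall i : int,
        realization R (X (i + 1)) -> realization R (X i)),
      admissible proj m ->
      exists (d : measure_display) (Z : measurableType d)
        (mu : {measure set Z -> \bar R})
        (f : inverse_limit proj -> LspaceType1 mu),
        (forall x y : inverse_limit proj,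
          (L1_dist (f x) (f y) <= (dbar m x y)%:E)%E) /\
        (forall x y : inverse_limit proj,
          ((L^-1 * dbar m x y)%:E <= L1_dist (f x) (f y))%E).
Proof.
have m0 : 0 < m%:R :> R by rewrite ltr0n; lia.
pose k : R := split_rate R m / 2.
have half0 : 0 < half_rate R m by rewrite /half_rate divr_gt0 // mulr_gt0 // invr_gt0 mulr_gt0.
have k0 : 0 < k.
  by rewrite /k /split_rate divr_gt0 // mulr_gt0 // invr_gt0 mulr_gt0.
exists (Num.max 1 (2 * m%:R / k)); split; first by rewrite le_max lexx.
set L := Num.max 1 _ => X proj adm.
have L0 : 0 < L by rewrite lt_max ltr01.
(* Without a base point there is nothing to embed. *)
have [[x0]|noT] := pselect (inhabited (inverse_limit proj)); last first.
  exists _, (g_sigma_algebraType (@set0 (set unit))), (@mzero _ _ R).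
  by exists (fun x => False_rect _ (noT (inhabits x))); split=> x; case: (noT (inhabits x)).
pose T : choiceType := {classic (inverse_limit proj)}.
pose c i (x : T) := limit_cell i x.
have parent_c i x : parent (level_hom adm i) (c (i + 1) x) = c i x.
  exact: parent_limit_cell.
have ev (x y : T) : exists k, near (c k x) (c k y) by exact: limit_eventually_near adm x y.
pose C := @cut_constraint R m X T c.
have Ctotal (x y : T) : exists a b, C (x, y, a, b).
  have [i /(near_common_star) [v [xv yv]]] := limit_eventually_near adm x y.
  exists 0, (2 * scale R m i), i, v; split; rewrite ?/c //=.
  - exact: closed_star_in_star.
  - exact: closed_star_in_star.
  - by left.
have [d [Z [mu [f [rho [prho fE rhoC]]]]]] :=
  @L1_embedding_from_finite_cuts R T x0 C Ctotal
    (fun s => @finite_cuts R m hm X (level_hom adm) T c parent_c ev s).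
exists d, Z, mu, f; split=> x y; rewrite fE lee_fin.
  apply: (le_dbar adm) => // i v a b av bv.
  have /rhoC/andP[_ //] : C (a, b, 0, 2 * scale R m i).
  by exists i, v; split; [exact: closed_star_in_star|exact: closed_star_in_star| |left].
have [dle|[i [ni nn]]] := dbar_dichotomy adm x y.
  have [rho0 _ _ _] := prho; apply: le_trans (rho0 x y).
  rewrite pmulr_rle0 ?invr_gt0 // leNgt; apply/negP => d0.
  have := dle (dbar m x y / 2) (divr_gt0 d0 _); lra.
have /rhoC/andP[lb _] : C (x, y, k * scale R m (i + 1), 2 * scale R m i).
  have [v [xv yv]] := near_common_star ni.
  exists i, v; split; [exact: closed_star_in_star|exact: closed_star_in_star| by []|].
  by right.
apply: le_trans lb; rewrite mulrC ler_pdivrMr //.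
apply: le_trans (dbar_le adm ni) _; rewrite (scaleS R hm i).
have s0 : 0 < scale R m i by exact: scale_gt0.
have : 2 * m%:R / k <= L by rewrite le_max lexx orbT.
rewrite ler_pdivrMr // => Lk.
have -> : 2 * scale R m i = 2 * m%:R * (scale R m i / m%:R).
  by field; rewrite gt_eqF.
have -> : k * (scale R m i / m%:R) * L = L * k * (scale R m i / m%:R) by ring.
apply: ler_wpM2r Lk.
by rewrite divr_ge0 // ltW.
Qed.
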